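(* Assume that $R=\mathbb K[x_1]_p[x_2;\sigma_2,\delta_2]_p\cdots[x_N;\sigma_N,\delta_N]_p$ is a Poisson-CGL extension of length $N$ with torus $\mathcal H$, and $k\in[1,N-1]$ is such that $\delta_{k+1}(x_k)\in\mathbb K$. Denote by $y_1,\dots,y_N$ and $\eta:[1,N]\to\mathbb Z$ the associated sequence of homogeneous Poisson-prime elements and function, and suppose $\eta(k)=\eta(k+1)$. Assume that $R$ has a second Poisson-CGL extension presentation (for the same torus $\mathcal H$) of the form $$R=\mathbb K[x_1]_p\cdots[x_{k-1};\sigma_{k-1},\delta_{k-1}]_p[x_{k+1};\sigma'_k,\delta'_k]_p[x_k;\sigma'_{k+1},\delta'_{k+1}]_p[x_{k+2};\sigma_{k+2},\delta_{k+2}]_p\cdots[x_N;\sigma_N,\delta_N]_p,$$ and let $y'_1,\dots,y'_N$ be the sequence of homogeneous Poisson-prime elements associated to the second presentation. Put $y_{-\infty}:=1$ and $P(k-1)=\{j\in[1,k-1]\mid s(j)>k-1\}$. Then there exist $\kappa\in\mathbb K^*$ and a collection of nonnegative integers $\{m_i\mid i\in P(k-1),\ i\ne p(k)\}$ such that $$y'_k=y_k^{-1}\Big(y_{p(k)}y_{k+1}+\kappa\prod_{i\in P(k-1),\ i\neq p(k)}y_i^{m_i}\Big).$$ If $p(k)=-\infty$, then all $m_i=0$.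
   Context: $\mathbb K$ is a field of characteristic $0$; algebras are $\mathbb K$-algebras, derivations are $\mathbb K$-linear; $[j,k]=\{j,\dots,k\}$. A Poisson algebra is a commutative algebra with a Lie bracket $\{-,-\}$ that is a derivation in each variable. A Poisson action is an action by algebra automorphisms preserving the bracket. A Poisson derivation $\sigma$ of $B$ is a derivation for both product and bracket; a Poisson $\sigma$-derivation is a derivation $\delta$ for the product with $\delta(\{a,b\})=\{\delta(a),b\}+\{a,\delta(b)\}+\sigma(a)\delta(b)-\delta(a)\sigma(b)$. The Poisson-Ore extension $B[x;\sigma,\delta]_p$ is $B[x]$ with the unique Poisson bracket extending that of $B$ with $\{x,b\}=\sigma(b)x+\delta(b)$. For a rational action of a torus $\mathcal H\cong(\mathbb K^* )^r$, homogeneous elements are the $\mathcal H$-eigenvectors and $0$; $\mathrm{Lie}\,\mathcal H\cong\mathbb K^r$ acts by the differential: if $a$ is an $\mathcal H$-eigenvector with eigenvalue $h\mapsto h_1^{u_1}\cdots h_r^{u_r}$, then $\xi\cdot a=(u_1\xi_1+\dots+u_r\xi_r)a$. A Poisson-prime element of a Poisson domain $A$ is a nonzero $c$ with $\{c,A\}\subseteq Ac$ and $A/(c)$ a domain. A Poisson-CGL (P-CGL) extension of length $N$ is an iterated Poisson-Ore extension $R=\mathbb K[x_1]_p[x_2;\sigma_2,\delta_2]_p\cdots[x_N;\sigma_N,\delta_N]_p$ ($\sigma_1=\delta_1=0$; $R_k:=\mathbb K[x_1,\dots,x_k]$, $R_0=\mathbb K$) with a rational Poisson action of a torus $\mathcal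 H$ such that (i) each $x_k$ is an $\mathcal H$-eigenvector; (ii) for $k\in[2,N]$, $\delta_k$ is a locally nilpotent Poisson $\sigma_k$-derivation of $R_{k-1}$; (iii) for $k\in[1,N]$ there is $h_k\in\mathrm{Lie}\,\mathcal H$ with $\sigma_k=(h_k\cdot)|_{R_{k-1}}$ and the $h_k$-eigenvalue $\lambda_k$ of $x_k$ is nonzero. For $\eta:[1,N]\to\mathbb Z$: $p(k)=\max\{j<k\mid\eta(j)=\eta(k)\}$, $s(k)=\min\{j>k\mid\eta(j)=\eta(k)\}$ ($\max\varnothing=-\infty$, $\min\varnothing=+\infty$). For every P-CGL extension there exist $\eta$ and homogeneous $c_k\in R_{k-1}$ (for $p(k)\neq-\infty$) such that the elements $y_k:=y_{p(k)}x_k-c_k$ if $p(k)\ne-\infty$, $y_k:=x_k$ if $p(k)=-\infty$, are homogeneous and for every $k$ the set $\{y_j\mid j\in[1,k],\,s(j)>k\}$ is a list of the homogeneous Poisson-prime elements of $R_k$ up to scalar multiples; the $y_k$, the level sets of $\eta$, and $p,s$ are uniquely determined by the presentation. These are the sequence and function ''associated to'' a presentation (for the second presentation, $x_{k+1}$ is the $k$-th and $x_k$ the $(k+1)$-st adjoined variable). *)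

(* Defs.v *)
From HB Require Import structures.
From mathcomp Require Import all_boot all_order all_fingroup all_algebra.
From mathcomp Require Export fraction.
From mathcomp Require Export mpoly.

Set Implicit Arguments.
Unset Strict Implicit.
Unset Printing Implicit Defensive.

Import GRing.Theory.
Local Open Scope ring_scope.

(* Indices are 0-based: the i-th adjoined variable has index i : 'I_N, and for
   m : nat, R_m is generated by the m first adjoined variables.  Subspaces of
   an algebra are predicates; maps defined on a subspace A are total functions
   whose values outside A are never used. *)

Section Torus.
Variables (K : fieldType) (r : nat).

(* The torus (K^* )^r is the subset [in_torus] of {ffun 'I_r -> K}. *)
Definition in_torus (h : {ffun 'I_r -> K}) : bool := [forall i, h i != 0].
Definition torus_mul (g h : {ffun 'I_r -> K}) : {ffun 'I_r -> K} :=
  [ffun i => g i * h i].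
Definition torus_one : {ffun 'I_r -> K} := [ffun=> 1].

Definition torus_char (u : 'I_r -> int) (h : {ffun 'I_r -> K}) : K :=
  \prod_(i < r) h i ^ u i.

(* Regular functions on the torus: Laurent polynomials in the coordinates. *)
Definition torus_regular (f : {ffun 'I_r -> K} -> K) : Prop :=
  exists s : seq (K * {ffun 'I_r -> int}),
    forall h, in_torus h -> f h = \sum_(t <- s) t.1 * torus_char t.2 h.

Variables (A : algType K) (act : {ffun 'I_r -> K} -> A -> A).

Definition torus_action : Prop :=
  (forall a, act torus_one a = a) /\
  (forall g h, in_torus g -> in_torus h ->
     forall a, act (torus_mul g h) a = act g (act h a)).

(* Each element lies in a finite-dimensional stable subspace, with basis v,
   on which the torus acts through a morphism of algebraic groups to GL. *)
Definition torus_rational : Prop :=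
  forall a : A, exists (n : nat) (v : 'I_n -> A)
    (rho : 'I_n -> 'I_n -> {ffun 'I_r -> K} -> K),
    [/\ forall e : 'I_n -> K, \sum_i e i *: v i = 0 -> forall i, e i = 0,
        forall i j, torus_regular (rho i j),
        forall h, in_torus h ->
          forall j, act h (v j) = \sum_i rho i j h *: v i
      & exists e : 'I_n -> K, a = \sum_i e i *: v i].

Definition homogeneous (a : A) : Prop :=
  forall h, in_torus h -> exists l : K, act h a = l *: a.

Definition has_weight (u : 'I_r -> int) (a : A) : Prop :=
  forall h, in_torus h -> act h a = torus_char u h *: a.

(* D is the action of xi in Lie(torus) = K^r.  For a rational action the
   algebra is spanned by weight vectors, so D exists and is unique. *)
Definition lie_act (xi : 'I_r -> K) (D : {linear A -> A}) : Prop :=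
  forall u a, has_weight u a -> D a = (\sum_(i < r) (u i)%:~R * xi i) *: a.

End Torus.

Section Poisson.
Variables (K : fieldType) (A : comAlgType K) (pb : A -> A -> A).

Definition poisson_bracket : Prop :=
  [/\ forall l a b c, pb (l *: a + b) c = l *: pb a c + pb b c,
      forall a, pb a a = 0,
      forall a b, pb a b = - pb b a,
      forall a b c, pb a (pb b c) + pb b (pb c a) + pb c (pb a b) = 0
    & forall a b c, pb a (b * c) = pb a b * c + b * pb a c].

Definition poisson_action (r : nat) (act : {ffun 'I_r -> K} -> A -> A) : Prop :=
  torus_action act /\
  forall h, in_torus h ->
    [/\ forall l a b, act h (l *: a + b) = l *: act h a + act h b,
        act h 1 = 1,
        forall a b, act h (a * b) = act h a * act h b
      & forall a b, act h (pb a b) = pb (act h a) (act h b)].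

Variable B : {pred A}.

Definition derivation_on (d : A -> A) : Prop :=
  [/\ {in B, forall a, d a \in B},
      forall l, {in B &, forall a b, d (l *: a + b) = l *: d a + d b}
    & {in B &, forall a b, d (a * b) = d a * b + a * d b}].

Definition poisson_derivation_on (s : A -> A) : Prop :=
  derivation_on s /\
  {in B &, forall a b, s (pb a b) = pb (s a) b + pb a (s b)}.

Definition poisson_sderivation_on (s d : A -> A) : Prop :=
  derivation_on d /\
  {in B &, forall a b,
     d (pb a b) = pb (d a) b + pb a (d b) + s a * d b - d a * s b}.

Definition locally_nilpotent_on (d : A -> A) : Prop :=
  {in B, forall a, exists n, iter n d a = 0}.

Definition divides_in (c a : A) : Prop := exists2 b, b \in B & a = b * c.

(* The last two clauses say that B/(c) is a nonzero ring without zero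
   divisors. *)
Definition poisson_prime_in (c : A) : Prop :=
  [/\ c \in B, c != 0,
      {in B, forall a, divides_in c (pb c a)},
      ~ divides_in c 1
    & {in B &, forall a b,
         divides_in c (a * b) -> divides_in c a \/ divides_in c b}].

End Poisson.

Section Levels.
Variables (N : nat) (eta : 'I_N -> int).

(* [None] stands for -oo in [eta_pred] and for +oo in [eta_succ]. *)
Definition eta_pred (k : 'I_N) : option 'I_N :=
  [pick j : 'I_N | [&& (j < k)%N, eta j == eta k
     & [forall i : 'I_N, ((i < k)%N && (eta i == eta k)) ==> (i <= j)%N]]].

Definition eta_succ (k : 'I_N) : option 'I_N :=
  [pick j : 'I_N | [&& (k < j)%N, eta j == eta k
     & [forall i : 'I_N, ((k < i)%N && (eta i == eta k)) ==> (j <= i)%N]]].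

(* The indices among the m first whose successor is not among the m first. *)
Definition last_levels (m : nat) : {set 'I_N} :=
  [set j : 'I_N | (j < m)%N &&
     (if eta_succ j is Some i then (m <= i)%N else true)].

End Levels.

Section CGL.
Variables (K : fieldType) (N r : nat).
Local Notation R := {mpoly K[N]}.
Variables (pb : R -> R -> R) (act : {ffun 'I_r -> K} -> R -> R).

(* A presentation of K[X_0, ..., X_(N-1)] adjoins the variables in the order
   'X_(w 0), 'X_(w 1), ... given by a permutation w. *)
Variable w : 'S_N.

(* R_m: polynomials involving only 'X_(w i) for i < m. *)
Definition stage (m : nat) : {pred R} :=
  [pred a : R | all (fun e : 'X_{1..N} =>
     [forall i : 'I_N, (m <= i)%N ==> (e (w i) == 0%N)]) (msupp a)].

(* At k = 0 the conditions on sigma k, delta k say that they vanish on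
   stage 0 = K.  The clause on pb 'X_(w k) makes each stage closed under pb. *)
Definition poisson_CGL (sigma delta : 'I_N -> R -> R) : Prop :=
  [/\ poisson_bracket pb,
      poisson_action pb act,
      torus_rational act,
      forall k, homogeneous act 'X_(w k)
    & forall k : 'I_N,
      [/\ poisson_derivation_on pb (stage k) (sigma k),
          poisson_sderivation_on pb (stage k) (sigma k) (delta k),
          {in stage k, forall b,
             pb 'X_(w k) b = sigma k b * 'X_(w k) + delta k b},
          locally_nilpotent_on (stage k) (delta k)
        & exists (xi : 'I_r -> K) (D : {linear R -> R}) (lambda : K),
          [/\ lie_act act xi D, {in stage k, sigma k =1 D},
              D 'X_(w k) = lambda *: 'X_(w k) & lambda != 0]]].

Definition homogeneous_primes (eta : 'I_N -> int) (y : 'I_N -> R) : Prop :=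
  exists c : 'I_N -> R,
  [/\ forall k, eta_pred eta k -> c k \in stage k /\ homogeneous act (c k),
      forall k, y k = if eta_pred eta k is Some j
                      then y j * 'X_(w k) - c k else 'X_(w k),
      forall k, homogeneous act (y k)
    & forall k : 'I_N, let P := last_levels eta k.+1 in
      [/\ {in P, forall j, poisson_prime_in pb (stage k.+1) (y j)},
          forall a, homogeneous act a -> poisson_prime_in pb (stage k.+1) a ->
            exists2 j, j \in P & exists2 l : K, l != 0 & a = l *: y j
        & {in P &, forall i j, i != j -> forall l : K, y i <> l *: y j}]].

End CGL.

(* Main.v *)
Require Import Defs.
From HB Require Import structures.
From mathcomp Require Import all_boot all_order all_fingroup all_algebra.
From mathcomp Require Import ring.
From Stdlib Require Import Classical.

(** Write A for the algebra of the variables before x = x_k, put z = x_(k+1),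
    and let q be y_(p(k)), or 1 if k has no predecessor; then y_k = q x - c
    with c in A.

    Both sequences list the homogeneous Poisson-primes of the stages, so they
    agree up to scalars wherever the stages do, and the coefficients q fix the
    scalars ([presentations_agree]).  At the stage that contains both x and z,
    y_(k+1) is proportional to y'_(k+1).  Its coefficient of xz can be read off
    in either presentation: this shows that k is the predecessor of k+1 for the
    second presentation too, that y_(k+1) = y'_(k+1), and that y'_k = q z - c'
    with the same q and with c' in A ([exchange_data]).

    Let u = y_k y'_k - q y_(k+1).  Since y_(k+1) = y_k z - d = y'_k x - d',
    where d does not involve z and d' does not involve x, the element u
    involves neither x nor z: it lies in A.  It is homogeneous, and nonzero
    because the prime y_(k+1) divides neither y_k nor y'_k.  It is also
    Poisson-normal: if {q, a} = t q, then {-, a} multiplies y_k, y'_k and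
    y_(k+1) by sigma_k(a) + t, sigma_(k+1)(a) + t and
    sigma_k(a) + sigma_(k+1)(a) + t respectively.

    A nonzero homogeneous Poisson-normal element of a stage is a scalar times a
    product of the homogeneous Poisson-primes of that stage ([normal_factor]).
    This replaces unique factorization by a computation with an Euler operator.
    Let v be such an element of the stage of x_m, y = y_m and l = lead of y, and
    let D be the action of h_m.  The derivations lambda y^2 d/dx_m and
    y l D + y {l, -} - l {y, -} coincide on this stage ([euler_identity]), and
    the second one maps v to a multiple of v.  So if y does not divide v, then v divides
    dv/dx_m, which forces dv/dx_m = 0: once its factors y are removed, v comes
    from the previous stage.  The predecessor of m does not occur in v, for it
    is no longer Poisson-normal when x_m is adjoined ([lead_not_normal]).

    Apply this to u.  If k has a predecessor, the prime q does not divide u, for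
    otherwise it would divide c c', hence c or c', and y_k or y'_k would not be
    prime; so u is a scalar times a product of y_i with i <> p(k).  If k has no
    predecessor, then q = 1 and c = c' = 0, and the bracket {y_(k+1), x},
    computed in both presentations, gives lambda' u = - delta_(k+1)(x) with
    lambda' <> 0, so u is a scalar. *)

Set Implicit Arguments.
Unset Strict Implicit.
Unset Printing Implicit Defensive.

Import GRing.Theory.
Local Open Scope ring_scope.

(** * Degree in one variable *)

Lemma poly_lin_inj (S : nzRingType) (a b c d : S) :
  a%:P * 'X + b%:P = c%:P * 'X + d%:P -> a = c /\ b = d.
Proof.
move=> E; split.
  by have := congr1 (coefp 1) E; rewrite /= !coefD !coefMX !coefC /= !addr0.
by have := congr1 (coefp 0) E; rewrite /= !coefD !coefMX !coefC /= !add0r.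
Qed.

Section Degree.
Variables (K : fieldType) (N : nat).
Local Notation R := {mpoly K[N]}.
Implicit Types (a b c q : R) (i j : 'I_N) (w : 'S_N).

Definition indep i : {pred R} :=
  [pred a : R | all (fun e : 'X_{1..N} => e i == 0%N) (msupp a)].

Lemma indepP i a :
  reflect {in msupp a, forall e : 'X_{1..N}, e i = 0%N} (a \in indep i).
Proof. by apply: (iffP allP) => h e /h /eqP. Qed.

Fact indep_subring i : subring_closed (indep i).
Proof.
split.
- by apply/indepP => e; rewrite msupp1 inE => /eqP ->; rewrite mnm0E.
- move=> a b /indepP ha /indepP hb; apply/indepP => e /msuppB_le.
  by rewrite mem_cat => /orP[/ha|/hb].
- move=> a b /indepP ha /indepP hb; apply/indepP => e /msuppM_le.
  by case/allpairsP => -[d f] /= [/ha hd /hb hf ->]; rewrite mnmDE hd hf.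
Qed.
HB.instance Definition _ i :=
  GRing.isSubringClosed.Build R (indep i) (indep_subring i).

Lemma indepZ i l a : a \in indep i -> l *: a \in indep i.
Proof. by move=> /indepP ha; apply/indepP => e /msuppZ_le /ha. Qed.

Lemma indepC i (l : K) : l%:MP \in indep i.
Proof. by rewrite -alg_mpolyC indepZ ?rpred1. Qed.

Lemma indepX i j : i != j -> ('X_j : R) \in indep i.
Proof.
move=> ij; apply/indepP => e; rewrite msuppX inE => /eqP ->.
by rewrite mnm1E eq_sym (negPf ij).
Qed.

Lemma mpolyX_neq0 i : 'X_i != 0 :> R.
Proof.
apply/eqP => /(congr1 (mcoeff U_(i)%MM)).
by rewrite mcoeffX eqxx mcoeff0 => /eqP; rewrite oner_eq0.
Qed.

Lemma mderiv_indep i a : a \in indep i -> a^`M(i) = 0.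
Proof.
move=> /indepP ha; apply/mpolyP => e; rewrite mcoeff0 mcoeff_mderiv.
apply/eqP; apply: contraT; rewrite -mulr_natr mulf_eq0 negb_or -mcoeff_msupp => /andP[/ha].
by rewrite mnmDE mnm1E eqxx addn1.
Qed.

Lemma mderivX1 i : ('X_i)^`M(i) = 1 :> R.
Proof.
by rewrite mderivX mnm1E eqxx -[X in (X - _)%MM]add0m addmK scale1r mpolyX0.
Qed.

(** Reading leading coefficients by partial derivatives, which commute, also
    gives access to coefficients of products of two variables. *)
Lemma mderiv_lin i a b : a \in indep i -> b \in indep i -> (a * 'X_i + b)^`M(i) = a.
Proof.
move=> ha hb; rewrite mderivD mderivM (mderiv_indep ha) (mderiv_indep hb).
by rewrite mderivX1 mul0r mulr1 add0r addr0.
Qed.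

Lemma stageP w m a :
  reflect (forall i : 'I_N, (m <= i)%N -> a \in indep (w i)) (a \in stage w m).
Proof.
apply: (iffP allP) => [h i mi|h e he].
  by apply/indepP => e /h /forallP/(_ i)/implyP/(_ mi)/eqP.
by apply/forallP => i; apply/implyP => /h/indepP/(_ e he) ->.
Qed.

Fact stage_subring w m : subring_closed (@stage K N w m).
Proof.
split; first by apply/stageP => i _; apply: rpred1.
- by move=> a b /stageP ha /stageP hb; apply/stageP => i mi; rewrite rpredB ?ha ?hb.
- by move=> a b /stageP ha /stageP hb; apply/stageP => i mi; rewrite rpredM ?ha ?hb.
Qed.
HB.instance Definition _ w m :=
  GRing.isSubringClosed.Build R (@stage K N w m) (stage_subring w m).

Lemma stageC w m (l : K) : l%:MP \in stage w m.
Proof. by apply/stageP => i _; apply: indepC. Qed.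

Lemma stage_le w m n a : (m <= n)%N -> a \in stage w m -> a \in stage w n.
Proof.
by move=> mn /stageP ha; apply/stageP => i /(leq_trans mn) /ha.
Qed.

Lemma stage_indep w (k : 'I_N) a : a \in stage w k -> a \in indep (w k).
Proof. by move=> /stageP; apply. Qed.

Lemma stage_drop w (k : 'I_N) a :
  a \in stage w k.+1 -> a \in indep (w k) -> a \in stage w k.
Proof.
move=> /stageP ha hk; apply/stageP => i; rewrite leq_eqVlt => /orP[/eqP ki|/ha//].
by rewrite -(val_inj ki).
Qed.

Lemma stageX w (i : 'I_N) m : (i < m)%N -> ('X_(w i) : R) \in stage w m.
Proof.
move=> im; apply/stageP => j mj; apply: indepX; rewrite (inj_eq perm_inj).
by apply: contraTneq mj => ->; rewrite -ltnNge.
Qed.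

(** A polynomial read as one in the single variable X_i, the other variables
    being moved into the coefficients: the source of all degree arguments in
    one variable. *)
Definition upoly i : R -> {poly R} :=
  mmap ((@polyC R) \o (@mpolyC N K))
       (fun j => if j == i then 'X else ('X_j : R)%:P).
HB.instance Definition _ i := GRing.RMorphism.on (upoly i).

Lemma upolyC i l : upoly i l%:MP = (l%:MP)%:P.
Proof. by rewrite /upoly mmapC. Qed.

Lemma upolyX i : upoly i 'X_i = 'X.
Proof. by rewrite /upoly mmapX mmap1U eqxx. Qed.

(** The factorization of a monomial into its power of X_i and the rest is
    needed both in the polynomial ring and after [upoly], with the same [b]. *)
Lemma upolyXm i (e : 'X_{1..N}) :
  exists2 b : R, b \in indep i & upoly i 'X_[e] = b%:P * 'X^(e i)
    /\ 'X_[e] = b * 'X_i ^+ e i :> R.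
Proof.
exists (\prod_(j < N | j != i) 'X_j ^+ e j).
  by apply: rpred_prod => j ji; rewrite rpredX // indepX // eq_sym.
split; last by rewrite mpolyXE_id (bigD1 i) //= mulrC.
rewrite /upoly mmapX /mmap1 (bigD1 i) //= eqxx mulrC; congr (_ * _).
by rewrite rmorph_prod; apply: eq_bigr => j /negPf ->; rewrite rmorphXn.
Qed.

Lemma upoly_horner i a : (upoly i a).['X_i] = a.
Proof.
rewrite {1}[a]mpolyE [RHS]mpolyE rmorph_sum horner_sum; apply: eq_bigr => e _.
have [b _ [h1 h2]] := upolyXm i e.
by rewrite -!mul_mpolyC rmorphM /= upolyC h1 !hornerE /= h2 mulrA.
Qed.

Lemma upoly_inj i : injective (upoly i).
Proof. by move=> a b ab; rewrite -[a](upoly_horner i) ab upoly_horner. Qed.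

Lemma upoly_coef i a n : (upoly i a)`_n \in indep i.
Proof.
rewrite [a]mpolyE rmorph_sum coef_sum; apply: rpred_sum => e _.
have [b hb [h1 _]] := upolyXm i e.
rewrite -mul_mpolyC rmorphM /= upolyC h1 !coefCM coefXn.
by rewrite !rpredM ?indepC ?rpred_nat.
Qed.

Lemma upoly_indep i a : a \in indep i -> upoly i a = a%:P.
Proof.
move=> /indepP ha; rewrite {1}[a]mpolyE rmorph_sum [in RHS](mpolyE a) rmorph_sum.
apply: eq_big_seq => e /ha e0.
have [b _ [h1 h2]] := upolyXm i e.
by rewrite -!mul_mpolyC !rmorphM /= upolyC h1 h2 e0 !expr0 !mulr1.
Qed.

Lemma indep_upoly i a b : upoly i a = b%:P -> a \in indep i.
Proof.
move=> h; rewrite -[a](upoly_horner i) h hornerC.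
by have := upoly_coef i a 0; rewrite h coefC.
Qed.

(** The degree in X_i of a product of nonzero polynomials is the sum of the
    degrees, so it vanishes only if both do. *)
Lemma indep_divisor i a b : a * b \in indep i -> a * b != 0 -> a \in indep i.
Proof.
move=> /upoly_indep h nz; have sz: size (upoly i a * upoly i b) = 1%N.
  by rewrite -(rmorphM (upoly i)) /= h size_polyC nz.
have [a0 b0]: upoly i a != 0 /\ upoly i b != 0.
  by apply/norP; rewrite -mulf_eq0 -size_poly_eq0 sz.
have le1 m n : (m + n).-1 = 1%N -> (0 < n)%N -> (m <= 1)%N.
  by case: n => // n; rewrite addnS /= => <- _; apply: leq_addr.
have: (size (upoly i a) <= 1)%N.
  by apply: le1 (size (upoly i b)) _ _; rewrite -?(size_mul a0 b0) ?size_poly_gt0.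
by move/size1_polyC; apply: indep_upoly.
Qed.

(** The degree in X_i forces t to be constant in X_i, after which
    coefficients can be compared.  Applied to t * y k, it identifies the
    quotients and eigenvalues attached to a Poisson-prime. *)
Lemma indep_lin i t q c a b :
    q \in indep i -> c \in indep i -> a \in indep i -> b \in indep i ->
    q != 0 -> t * (q * 'X_i - c) = a * 'X_i + b ->
  [/\ t \in indep i, t * q = a & t * c = - b].
Proof.
move=> hq hc ha hb q0 E.
have F : upoly i t * (q%:P * 'X - c%:P) = a%:P * 'X + b%:P.
  have := congr1 (upoly i) E; rewrite rmorphM rmorphB rmorphD /=.
  rewrite (rmorphM _ q) (rmorphM _ a) /= upolyX.
  by rewrite (upoly_indep hq) (upoly_indep hc) (upoly_indep ha) (upoly_indep hb).
have sz2 : size (q%:P * 'X - c%:P) = 2%N.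
  by rewrite -polyCN size_MXaddC polyC_eq0 (negPf q0) /= size_polyC q0.
have ht : t \in indep i.
  have [->|t0] := eqVneq t 0; first exact: rpred0.
  have T0 : upoly i t != 0.
    by apply: contraNneq t0 => h; apply/eqP/(@upoly_inj i); rewrite h rmorph0.
  have B0 : q%:P * 'X - c%:P != 0 by rewrite -size_poly_eq0 sz2.
  have : (size (upoly i t * (q%:P * 'X - c%:P))%R <= 2)%N.
    by rewrite F size_MXaddC; case: ifP => // _; rewrite ltnS size_polyC_leq1.
  rewrite (size_mul T0 B0) sz2 addn2 /= ltnS => /size1_polyC; exact: indep_upoly.
rewrite (upoly_indep ht) mulrBr mulrA -!polyCM -polyCN in F.
by have [-> <-] := poly_lin_inj F; rewrite opprK.
Qed.

End Degree.

(** * Weights of a rational torus action *)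

Section TorusWeights.
Variables (K : fieldType) (r : nat).
Local Notation T := {ffun 'I_r -> K}.
Implicit Types (g h : T) (u v : 'I_r -> int).

Lemma in_torus1 : in_torus (torus_one K r).
Proof. by apply/forallP => i; rewrite ffunE oner_neq0. Qed.

Lemma in_torusM g h : in_torus g -> in_torus h -> in_torus (torus_mul g h).
Proof.
by move=> /forallP hg /forallP hh; apply/forallP => i; rewrite ffunE mulf_neq0.
Qed.

Lemma torus_char_neq0 u h : in_torus h -> torus_char u h != 0.
Proof.
by move=> /forallP hh; rewrite prodf_seq_neq0; apply/allP => i _; rewrite expfz_neq0.
Qed.

Lemma torus_charM u g h : torus_char u (torus_mul g h) = torus_char u g * torus_char u h.
Proof.
rewrite /torus_char -big_split; apply: eq_bigr => i _.
by rewrite ffunE expfzMl.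
Qed.

Lemma torus_charD u v h : in_torus h ->
  torus_char (fun i => u i + v i) h = torus_char u h * torus_char v h.
Proof.
move=> /forallP hh; rewrite /torus_char -big_split; apply: eq_bigr => i _.
by rewrite expfzDr.
Qed.

(** Dedekind's independence of characters: if l differs at g from the
    character chi of one of its terms, then l(gh) - chi(g) l(h) is a nonzero
    multiple of l(h) from which that term has disappeared. *)
Lemma multiplicative_regular_char (l : T -> K) :
    torus_regular l -> l (torus_one K r) != 0 ->
    (forall g h, in_torus g -> in_torus h -> l (torus_mul g h) = l g * l h) ->
  exists u, forall h, in_torus h -> l h = torus_char u h.
Proof.
move=> [s ls] l1 lM; have [n] := ubnP (size s); elim: n s ls => // n IH [|t s] ls.
  by case/eqP: l1; rewrite ls ?in_torus1 // big_nil.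
rewrite ltnS /= => sn.
have [[g [hg gt]]|nt] := classic (exists g, in_torus g /\ l g != torus_char t.2 g);
  last first.
  exists t.2 => h hh; apply/eqP; apply: contra_notT nt => lh.
  by exists h.
pose d := l g - torus_char t.2 g.
have d0 : d != 0 by rewrite subr_eq0.
(* The terms of l(gh) - chi(g) l(h), rescaled so as to sum up to l. *)
pose f (x : K * {ffun 'I_r -> int}) :=
  (x.1 * (torus_char x.2 g - torus_char t.2 g) / d, x.2).
apply: (IH (map f s)); last by rewrite size_map.
move=> h hh; apply: (mulfI d0); rewrite mulrBl -lM //.
rewrite !ls ?in_torusM // !big_cons mulrDr torus_charM mulrA (mulrCA _ t.1) -mulrA.
rewrite opprD addrACA subrr add0r.
rewrite !mulr_sumr -sumrB big_map; apply: eq_bigr => x _ /=.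
by rewrite torus_charM; field.
Qed.

End TorusWeights.

Section Rational.
Variables (K : fieldType) (r : nat) (A : algType K) (act : {ffun 'I_r -> K} -> A -> A).

(** In a finite-dimensional stable subspace the eigenvalue of [a] is a
    combination of matrix entries, hence a regular function of the torus
    element; being multiplicative, it is a character. *)
Lemma homogeneous_weight a :
    torus_action act -> torus_rational act ->
    (forall h, in_torus h -> forall (l : K) b, act h (l *: b) = l *: act h b) ->
    (forall h, in_torus h -> forall b c, act h (b + c) = act h b + act h c) ->
    a != 0 -> homogeneous act a -> exists u, has_weight act u a.
Proof.
move=> [act1 actM] rat actZ actD a0 ha.
have [n [v [rho [vfree rreg rhoE [e ae]]]]] := rat a.
have [i0 ei0] : exists i, e i != 0.
  apply: NNPP => ne; case/eqP: a0; rewrite ae big1 // => i _.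
  by have [->|ei] := eqVneq (e i) 0; rewrite ?scale0r //; case: ne; exists i.
pose l h := (\sum_j e j * rho i0 j h) / e i0.
have act0 h : in_torus h -> act h 0 = 0.
  by move=> hh; apply: (addrI (act h 0)); rewrite -actD // !addr0.
have actE h : in_torus h -> act h a = \sum_i (\sum_j e j * rho i j h) *: v i.
  move=> hh; rewrite ae (big_morph (act h) (actD h hh) (act0 h hh)).
  rewrite (eq_bigr (fun j => \sum_i (e j * rho i j h) *: v i)); last first.
    by move=> j _; rewrite actZ // rhoE // scaler_sumr; apply: eq_bigr => i _; rewrite scalerA.
  by rewrite exchange_big; apply: eq_bigr => i _; rewrite scaler_suml.
have actl h : in_torus h -> act h a = l h *: a.
  move=> hh; have [m am] := ha h hh; rewrite am; congr (_ *: _).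
  suff /(_ i0)/eqP : forall i, \sum_j e j * rho i j h - m * e i = 0.
    by rewrite subr_eq0 /l => /eqP ->; rewrite mulfK.
  apply: vfree; apply/eqP.
  rewrite (eq_bigr (fun i => (\sum_j e j * rho i j h) *: v i - m *: (e i *: v i))).
    by rewrite sumrB -actE // -scaler_sumr -ae am subrr.
  by move=> i _; rewrite scalerBl scalerA.
have [||g h hg hh|u lu] := @multiplicative_regular_char K r l.
- have [s hs] := fin_all_exists (rreg i0).
  exists (flatten [seq [seq (e j / e i0 * t.1, t.2) | t <- s j] | j : 'I_n]).
  move=> h hh; rewrite big_flatten big_map /= /l mulr_suml big_enum /=.
  apply: eq_bigr => j _; rewrite big_map hs // mulrAC mulr_sumr.
  by apply: eq_bigr => t _ /=; rewrite mulrA.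
- have := actl _ (in_torus1 K r); rewrite act1 => /eqP.
  by apply: contraTneq => ->; rewrite scale0r.
- have := actl _ (in_torusM hg hh); rewrite actM // (actl h) // actZ // actl // scalerA => /eqP.
  rewrite eq_sym -subr_eq0 -scalerBl scaler_eq0 (negPf a0) orbF subr_eq0 => /eqP ->.
  exact: mulrC.
by exists u => h hh; rewrite actl ?lu.
Qed.

Lemma has_weightM u v a b :
    (forall h, in_torus h -> forall b c, act h (b * c) = act h b * act h c) ->
  has_weight act u a -> has_weight act v b ->
  has_weight act (fun i => u i + v i) (a * b).
Proof.
move=> actM ha hb h hh.
by rewrite actM // ha // hb // torus_charD // -scalerAl -scalerAr scalerA.
Qed.

Lemma has_weight1 :
    (forall h, in_torus h -> act h 1 = 1) -> has_weight act (fun=> 0) 1.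
Proof.
by move=> act1 h hh; rewrite act1 // /torus_char big1 ?scale1r.
Qed.

End Rational.

(** * Derivations and stages *)

Section Derivations.
Variables (K : fieldType) (N : nat).
Local Notation R := {mpoly K[N]}.

(** By the Leibniz rule, a derivation is controlled by its values on the
    variables.  With S a stage this shows that the derivation preserves it,
    and with S = 0 that two derivations coincide. *)
Lemma derivation_on_stage (w : 'S_N) m (E : R -> R) (S : R -> Prop) :
    (forall l a b, E (l *: a + b) = l *: E a + E b) ->
    (forall a b, E (a * b) = E a * b + a * E b) ->
    S 0 -> (forall a b, S a -> S b -> S (a + b)) ->
    (forall a b, a \in stage w m -> S b -> S (a * b)) ->
    (forall i : 'I_N, (i < m)%N -> S (E 'X_(w i))) ->
  forall a, a \in stage w m -> S (E a).
Proof.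
move=> EL EM S0 SD SM EX a ha.
have E0 : E 0 = 0 by apply: (addrI (E 0)); rewrite -[X in X + _]scale1r -EL scaler0 !addr0.
have E1 : E 1 = 0.
  by apply: (addrI (E 1)); rewrite addr0 -[in RHS](mulr1 1) EM mulr1 mul1r.
rewrite [a]mpolyE big_seq; elim/big_rec: _ => [|e b /(allP ha) /= /forallP he Sb].
  by rewrite E0.
rewrite EL; apply: (SD) => //; rewrite -mul_mpolyC; apply: (SM); first exact: stageC.
rewrite mpolyXE_id.
pose Q b := b \in stage w m /\ S (E b).
suff [] : Q (\prod_(i < N) 'X_i ^+ e i) by [].
apply: (big_ind Q); rewrite /Q.
- by rewrite E1 rpred1.
- move=> b1 b2 [h1 s1] [h2 s2]; split; first by rewrite rpredM.
  by rewrite EM; apply: (SD); [rewrite mulrC|]; apply: (SM).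
move=> i _; have := he ((w^-1)%g i); rewrite permKV.
have [_ /implyP/(_ isT)/eqP ->|im _] := leqP; first by rewrite expr0 E1 rpred1.
have := EX _ im; have := stageX K w im; rewrite permKV => hi Ei.
elim: (e i) => [|n [IH1 IH2]]; first by rewrite expr0 E1 rpred1.
rewrite exprS EM; split; first by rewrite rpredM.
by apply: SD; [rewrite mulrC|]; apply: SM.
Qed.

Variables (r : nat) (act : {ffun 'I_r -> K} -> R -> R) (xi : 'I_r -> K).
Variable (D : {linear R -> R}).

(** Monomials are weight vectors and weights add up in products, so the
    Leibniz rule holds for monomials, which span. *)
Lemma lie_act_derivation :
    (forall h, in_torus h -> act h 1 = 1) ->
    (forall h, in_torus h -> forall b c, act h (b * c) = act h b * act h c) ->
    (forall i : 'I_N, exists u, has_weight act u 'X_i) -> lie_act act xi D ->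
  forall a b, D (a * b) = D a * b + a * D b.
Proof.
move=> act1 actM wX DP.
have wm (e : 'X_{1..N}) : exists u, has_weight act u 'X_[e].
  rewrite mpolyXE_id; elim/big_ind: _ => [|a b [u hu] [v hv]|i _].
  - by exists (fun=> 0); apply: has_weight1.
  - by exists (fun i => u i + v i); apply: has_weightM.
  have [u hu] := wX i; elim: (e i) => [|n [v hv]].
    by exists (fun=> 0); rewrite expr0; apply: has_weight1.
  by exists (fun i => u i + v i); rewrite exprS; apply: has_weightM.
move=> a b; elim/mpolyind: a => [|c e a _ _ IHa].
  by rewrite !(mul0r, linear0) addr0.
rewrite mulrDl !linearD /= IHa !mulrDl addrACA; congr (_ + _).
rewrite -scalerAl !linearZ /= -!scalerAl -scalerDr; congr (_ *: _).
clear a IHa; elim/mpolyind: b => [|d f b _ _ IHb]; first by rewrite !(mulr0, linear0) addr0.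
rewrite mulrDr !linearD /= IHb !mulrDr addrACA; congr (_ + _).
rewrite -scalerAr !linearZ /= -!scalerAr -scalerDr; congr (_ *: _).
have [u hu] := wm e; have [v hv] := wm f.
rewrite (DP _ _ hu) (DP _ _ hv) (DP _ _ (has_weightM actM hu hv)).
rewrite -scalerAl -scalerAr -scalerDl -big_split; congr (_ *: _).
by apply: eq_bigr => i _; rewrite rmorphD mulrDl.
Qed.

End Derivations.

(** * Level sets *)

Section Levels.
Variables (N : nat) (eta : 'I_N -> int).

Lemma eta_predP (k j : 'I_N) :
  reflect [/\ (j < k)%N, eta j = eta k
             & forall i : 'I_N, (i < k)%N -> eta i = eta k -> (i <= j)%N]
          (eta_pred eta k == Some j).
Proof.
rewrite /eta_pred; case: pickP => [j'|no]; last first.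
  apply: (iffP eqP) => // -[jk ejk jm]; move: (no j); rewrite jk ejk eqxx /=.
  by move/forallP => []; move=> i; apply/implyP => /andP[ik /eqP]; apply: jm.
case/and3P => jk' /eqP ej' /forallP jm'.
have jmax (i : 'I_N) : (i < k)%N -> eta i = eta k -> (i <= j')%N.
  by move=> ik eik; have /implyP := jm' i; rewrite ik eik eqxx; apply.
apply: (iffP eqP) => [[<-] //|[jk ej jm]]; congr Some; apply: val_inj => /=.
by apply/eqP; rewrite eqn_leq jm // jmax.
Qed.

Lemma eta_succP (k j : 'I_N) :
  reflect [/\ (k < j)%N, eta j = eta k
             & forall i : 'I_N, (k < i)%N -> eta i = eta k -> (j <= i)%N]
          (eta_succ eta k == Some j).
Proof.
rewrite /eta_succ; case: pickP => [j'|no]; last first.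
  apply: (iffP eqP) => // -[jk ejk jm]; move: (no j); rewrite jk ejk eqxx /=.
  by move/forallP => []; move=> i; apply/implyP => /andP[ik /eqP]; apply: jm.
case/and3P => jk' /eqP ej' /forallP jm'.
have jmin (i : 'I_N) : (k < i)%N -> eta i = eta k -> (j' <= i)%N.
  by move=> ik eik; have /implyP := jm' i; rewrite ik eik eqxx; apply.
apply: (iffP eqP) => [[<-] //|[jk ej jm]]; congr Some; apply: val_inj => /=.
by apply/eqP; rewrite eqn_leq jmin ?jm.
Qed.

Lemma eta_pred_succ (i j : 'I_N) :
  (eta_pred eta i == Some j) = (eta_succ eta j == Some i).
Proof.
apply/eta_predP/eta_succP => -[ij eij jm]; split=> // l h1 h2.
  rewrite leqNgt; apply/negP => li.
  by have := jm _ li (etrans h2 eij); rewrite leqNgt h1.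
rewrite leqNgt; apply/negP => li.
by have := jm _ li (etrans h2 eij); rewrite leqNgt h1.
Qed.

(** Levels depend on the predecessor function only, so two functions with
    the same predecessors below m have the same last levels. *)
Lemma last_levelsP m (j : 'I_N) :
  reflect ((j < m)%N /\ forall i : 'I_N, (i < m)%N -> eta_pred eta i != Some j)
          (j \in last_levels eta m).
Proof.
rewrite inE; apply: (iffP andP) => -[jm h]; split=> //.
  move=> i im; rewrite eta_pred_succ; move: h; case: (eta_succ eta j) => // s ms.
  by apply: contraL im => /eqP[<-]; rewrite -leqNgt.
case E : (eta_succ eta j) => [i|] //; rewrite leqNgt; apply/negP => im.
by have /negP[] := h _ im; rewrite eta_pred_succ E.
Qed.

Lemma eta_pred_level (k j : 'I_N) : eta_pred eta k = Some j -> j \in last_levels eta k.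
Proof.
move/eqP/eta_predP => -[jk ejk jm]; apply/last_levelsP; split=> // i ik.
apply/negP => /eta_predP -[ji eji _].
by have := jm _ ik (etrans (esym eji) ejk); rewrite leqNgt ji.
Qed.

Lemma last_level_max (k : 'I_N) : k \in last_levels eta k.+1.
Proof.
apply/last_levelsP; split=> // i; rewrite ltnS => ik.
by apply/negP => /eta_predP -[]; rewrite ltnNge ik.
Qed.

Lemma last_levelsS (k : 'I_N) :
  last_levels eta k.+1 = k |: [set j in last_levels eta k | Some j != eta_pred eta k].
Proof.
apply/setP => j; rewrite in_setU1 inE.
apply/last_levelsP/orP => [[jk h]|[/eqP ->|]].
- have [->|njk] := eqVneq j k; first by left.
  right; rewrite eq_sym h // andbT; apply/last_levelsP; split.
    by rewrite ltn_neqAle -ltnS jk andbT.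
  by move=> i ik; apply: h; apply: ltnW.
- by have /last_levelsP := last_level_max k.
case/andP => /last_levelsP -[jk h] jp; split; first exact: ltnW.
move=> i; rewrite ltnS leq_eqVlt => /orP[/eqP ik|]; last exact: h.
by rewrite (val_inj ik) eq_sym.
Qed.

Lemma last_levels0 : last_levels eta 0%N = set0.
Proof. by apply/setP => j; rewrite in_set0. Qed.

End Levels.

(** * Poisson brackets *)

Section Bracket.
Variables (K : fieldType) (A : comAlgType K) (pb : A -> A -> A).
Hypothesis pbP : poisson_bracket pb.
Implicit Types (a b c : A) (l : K).

Lemma pb_anti a b : pb a b = - pb b a. Proof. by case: pbP. Qed.
Lemma pbxx a : pb a a = 0. Proof. by case: pbP. Qed.
Lemma pbMr a b c : pb a (b * c) = pb a b * c + b * pb a c. Proof. by case: pbP. Qed.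
Lemma pb_linl l a b c : pb (l *: a + b) c = l *: pb a c + pb b c.
Proof. by case: pbP. Qed.
Lemma pbDl a b c : pb (a + b) c = pb a c + pb b c.
Proof. by have := pb_linl 1 a b c; rewrite !scale1r. Qed.
Lemma pb0l c : pb 0 c = 0.
Proof. by apply: (addrI (pb 0 c)); rewrite -pbDl !addr0. Qed.
Lemma pbZl l a c : pb (l *: a) c = l *: pb a c.
Proof. by have := pb_linl l a 0 c; rewrite pb0l !addr0. Qed.
Lemma pbNl a c : pb (- a) c = - pb a c.
Proof. by rewrite -scaleN1r pbZl scaleN1r. Qed.
Lemma pbBl a b c : pb (a - b) c = pb a c - pb b c.
Proof. by rewrite pbDl pbNl. Qed.
Lemma pbMl a b c : pb (a * b) c = pb a c * b + a * pb b c.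
Proof. by rewrite pb_anti pbMr (pb_anti a) (pb_anti b) opprD mulNr mulrN. Qed.
Lemma pb_linr l a b c : pb c (l *: a + b) = l *: pb c a + pb c b.
Proof. by rewrite !(pb_anti c) pb_linl opprD scalerN. Qed.
Lemma pbBr a b c : pb c (a - b) = pb c a - pb c b.
Proof. by rewrite !(pb_anti c) pbBl opprB addrC opprK. Qed.
Lemma pb1l c : pb 1 c = 0.
Proof.
by apply: (addrI (pb 1 c)); rewrite addr0 -[in RHS](mulr1 1) pbMl mulr1 mul1r.
Qed.
Lemma pbXl a c n : pb (a ^+ n.+1) c = n.+1%:R * a ^+ n * pb a c.
Proof.
elim: n => [|n IH]; first by rewrite !expr1 expr0 !mul1r.
rewrite exprS pbMl IH -[n.+2]add1n natrD exprS; ring.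
Qed.

End Bracket.

(** * Poisson-CGL extensions *)

Section CGLFacts.
Variables (K : fieldType) (N r : nat).
Local Notation R := {mpoly K[N]}.
Variables (pb : R -> R -> R) (act : {ffun 'I_r -> K} -> R -> R) (w : 'S_N).
Variables (sigma delta : 'I_N -> R -> R).
Hypothesis cgl : poisson_CGL pb act w sigma delta.
Local Notation stage := (@stage K N w).
Implicit Types (a b c u v : R) (k : 'I_N) (m n : nat).

Lemma cgl_pb : poisson_bracket pb. Proof. by case: cgl. Qed.
Local Notation pbP := cgl_pb.

Lemma cgl_act1 h : in_torus h -> act h 1 = 1.
Proof. by case: cgl => _ [_ ha] _ _ _ /ha[]. Qed.
Lemma cgl_actM h : in_torus h -> forall a b, act h (a * b) = act h a * act h b.
Proof. by case: cgl => _ [_ ha] _ _ _ /ha[]. Qed.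
Lemma cgl_act_lin h : in_torus h ->
  forall l a b, act h (l *: a + b) = l *: act h a + act h b.
Proof. by case: cgl => _ [_ ha] _ _ _ /ha[]. Qed.
Lemma cgl_actD h : in_torus h -> forall a b, act h (a + b) = act h a + act h b.
Proof. by move=> hh a b; have := cgl_act_lin hh 1 a b; rewrite !scale1r. Qed.
Lemma cgl_act0 h : in_torus h -> act h 0 = 0.
Proof. by move=> hh; apply: (addrI (act h 0)); rewrite -cgl_actD // !addr0. Qed.
Lemma cgl_actZ h : in_torus h -> forall l a, act h (l *: a) = l *: act h a.
Proof. by move=> hh l a; have := cgl_act_lin hh l a 0; rewrite cgl_act0 // !addr0. Qed.
Lemma cgl_actB h : in_torus h -> forall a b, act h (a - b) = act h a - act h b.
Proof.
by move=> hh a b; rewrite cgl_actD // -scaleN1r cgl_actZ // scaleN1r.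
Qed.

Lemma cgl_homogeneousX (i : 'I_N) : homogeneous act 'X_i.
Proof. by case: cgl => _ _ _ hX _; have := hX ((w^-1)%g i); rewrite permKV. Qed.

Lemma cgl_weight a : homogeneous act a -> a != 0 -> exists x, has_weight act x a.
Proof.
case: cgl => _ [ta _] rat _ _ ha a0.
by apply: homogeneous_weight => // h hh; [apply: cgl_actZ|apply: cgl_actD].
Qed.

(** By rationality a nonzero homogeneous element is a weight vector, on which
    the Lie algebra acts by a scalar.  For the variables, this is what makes D
    a derivation of the whole ring. *)
Lemma cgl_lie k : exists (D : {linear R -> R}) (lambda : K),
  [/\ lambda != 0, forall a b, D (a * b) = D a * b + a * D b,
      {in stage k, sigma k =1 D}, D 'X_(w k) = lambda%:MP * 'X_(w k)
    & forall a, homogeneous act a -> exists l : K, D a = l%:MP * a].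
Proof.
have [_ _ _ _ /(_ k) [_ _ _ _ [xi [D [lambda [DP sE DX l0]]]]]] := cgl.
exists D, lambda; split=> //; last 2 first.
- by rewrite DX mul_mpolyC.
- move=> a ha; have [->|a0] := eqVneq a 0; first by exists 0; rewrite linear0 mulr0.
  by have [u /DP ->] := cgl_weight ha a0; eexists; rewrite mul_mpolyC.
apply: (lie_act_derivation cgl_act1 cgl_actM) DP => i.
apply: cgl_weight; first exact: cgl_homogeneousX.
by rewrite mpolyX_neq0.
Qed.

Lemma cgl_pbX k b : b \in stage k -> pb 'X_(w k) b = sigma k b * 'X_(w k) + delta k b.
Proof. by case: cgl => _ _ _ _ /(_ k)[_ _ h _ _] /h. Qed.

Lemma cgl_sigma_stage k b : b \in stage k -> sigma k b \in stage k.
Proof. by case: cgl => _ _ _ _ /(_ k)[[[h _ _] _] _ _ _ _] /h. Qed.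

Lemma cgl_delta_stage k b : b \in stage k -> delta k b \in stage k.
Proof. by case: cgl => _ _ _ _ /(_ k)[_ [[h _ _] _] _ _ _] /h. Qed.

(** Each bracket of two variables lies in the stage of the later one, by the
    formula for the bracket with the last adjoined variable. *)
Lemma pb_stage m a b : a \in stage m -> b \in stage m -> pb a b \in stage m.
Proof.
have XX (i j : 'I_N) : (i < m)%N -> (j < m)%N -> pb 'X_(w i) 'X_(w j) \in stage m.
  have XXlt (i' j' : 'I_N) : (i' < j')%N -> (j' < m)%N ->
      pb 'X_(w j') 'X_(w i') \in stage m.
    move=> ij jm; have h := stageX K w ij; rewrite cgl_pbX //.
    rewrite rpredD ?rpredM ?stageX //; apply: (@stage_le _ _ _ j'); rewrite 1?ltnW //.
      exact: cgl_sigma_stage.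
    exact: cgl_delta_stage.
  move=> im jm; have [ij|ji|/val_inj ->] := ltngtP i j.
  - by rewrite (pb_anti pbP) rpredN XXlt.
  - by rewrite XXlt.
  - by rewrite (pbxx pbP) rpred0.
have Xa (i : 'I_N) c : (i < m)%N -> c \in stage m -> pb 'X_(w i) c \in stage m.
  move=> im; apply: (derivation_on_stage (S := fun d => d \in stage m)).
  - by move=> l d e; apply: (pb_linr pbP).
  - exact: (pbMr pbP).
  - exact: rpred0.
  - by move=> d e; apply: rpredD.
  - by move=> d e; apply: rpredM.
  - by move=> j; apply: XX.
move=> ha hb; move: a ha.
apply: (derivation_on_stage (E := pb^~ b) (S := fun d => d \in stage m)).
- by move=> l d e; apply: (pb_linl pbP).
- by move=> d e; apply: (pbMl pbP).
- exact: rpred0.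
- by move=> d e; apply: rpredD.
- by move=> d e; apply: rpredM.
- by move=> j jm; apply: Xa.
Qed.

Lemma stage_divisor m a b : a * b \in stage m -> a * b != 0 -> a \in stage m.
Proof. by move=> /stageP h ab; apply/stageP => i /h /indep_divisor; apply. Qed.

(** The quotient ranges over the whole ring: it lies in the stage as soon as
    u and the bracket do, by [stage_divisor]. *)
Definition pnormal m u := forall a, a \in stage m -> exists g, pb u a = g * u.

Lemma poisson_prime_normal m u : poisson_prime_in pb (stage m) u -> pnormal m u.
Proof. by case=> _ _ h _ _ a /h [g _ ->]; exists g. Qed.

(** Primality inside a stage can be used with divisibility in the whole ring,
    because a stage contains the factors of its nonzero elements. *)
Lemma poisson_prime_dvdM m u a b c :
    poisson_prime_in pb (stage m) u -> a \in stage m -> b \in stage m ->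
    a * b = c * u -> (exists d, a = d * u) \/ (exists d, b = d * u).
Proof.
case=> hu u0 _ _ P ha hb E.
have : divides_in (stage m) u (a * b).
  have [ab0|ab0] := eqVneq (a * b) 0; first by exists 0; rewrite ?rpred0 // mul0r.
  exists c => //; apply: (@stage_divisor _ c u); rewrite -E //; exact: rpredM.
by case/(P _ _ ha hb) => -[d _ ->]; [left|right]; exists d.
Qed.

Lemma poisson_prime_nunit m u c :
  poisson_prime_in pb (stage m) u -> c * u <> 1.
Proof.
case=> hu u0 _ n1 _ E; apply: n1; exists c; rewrite ?E //.
by apply: (@stage_divisor _ c u); rewrite E ?rpred1 ?oner_neq0.
Qed.

Lemma pnormalM m u v : pnormal m u -> pnormal m v -> pnormal m (u * v).
Proof.
move=> hu hv a ha; have [g gE] := hu a ha; have [g' g'E] := hv a ha.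
by exists (g + g'); rewrite (pbMl pbP) gE g'E; ring.
Qed.

Lemma pnormalC m (l : K) : pnormal m l%:MP.
Proof.
by move=> a _; exists 0; rewrite -alg_mpolyC (pbZl pbP) (pb1l pbP) scaler0 mul0r.
Qed.

Lemma pnormal_div m u v : u != 0 -> pnormal m u -> pnormal m (u * v) -> pnormal m v.
Proof.
move=> u0 hu huv a ha; have [g gE] := hu a ha; have [g' g'E] := huv a ha.
exists (g' - g); apply: (mulfI u0); move: g'E; rewrite (pbMl pbP) gE => h.
apply: (addrI (g * u * v)); rewrite h; ring.
Qed.

Lemma homogeneous_div u v : u != 0 ->
  homogeneous act u -> homogeneous act (u * v) -> homogeneous act v.
Proof.
move=> u0 hu huv h hh; have [x xE] := cgl_weight hu u0; have [l lE] := huv h hh.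
exists (l / torus_char x h); apply: (mulfI u0).
apply: (@scalerI _ _ (torus_char x h)); first exact: torus_char_neq0.
rewrite scalerAl -xE // -cgl_actM // lE -scalerAr scalerA (mulrC (torus_char _ _)) divfK //.
exact: torus_char_neq0.
Qed.

End CGLFacts.

(** * Homogeneous Poisson-primes and Poisson-normal elements *)

Section Primes.
Variables (K : fieldType) (N r : nat).
Local Notation R := {mpoly K[N]}.
Variables (pb : R -> R -> R) (act : {ffun 'I_r -> K} -> R -> R) (w : 'S_N).
Variables (sigma delta : 'I_N -> R -> R).
Hypothesis cgl : poisson_CGL pb act w sigma delta.
Variables (eta : 'I_N -> int) (y : 'I_N -> R).
Hypothesis yP : homogeneous_primes pb act w eta y.
Local Notation stage := (@stage K N w).
Local Notation pnormal := (@pnormal K N pb w).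
Local Notation pbP := (cgl_pb cgl).
Local Notation x k := ('X_(w k) : R).
Implicit Types (a b c u v : R) (k i j : 'I_N) (m n : nat).

(** The coefficient of x k in y k, and its tail below; the value 1 makes the
    case without predecessor an instance of y k = lead k * x k - tail k. *)
Definition lead k : R := if eta_pred eta k is Some j then y j else 1.
Definition tail k : R := lead k * x k - y k.

Lemma yE k : y k = lead k * x k - tail k.
Proof. by rewrite /tail opprB addrC subrK. Qed.

Lemma y_homogeneous k : homogeneous act (y k).
Proof. by case: yP => c []. Qed.

Lemma level_prime m j : (m <= N)%N -> j \in last_levels eta m ->
  poisson_prime_in pb (stage m) (y j).
Proof.
move=> mN jm; have [jm' _] := last_levelsP _ _ _ jm.
case: m => [|m] // in mN jm jm' *.
by case: yP => c [_ _ _ /(_ (Ordinal mN))[h _ _]]; apply: h.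
Qed.

Lemma y_prime k : poisson_prime_in pb (stage k.+1) (y k).
Proof. exact: level_prime (ltn_ord k) (last_level_max eta k). Qed.

Lemma level_inj m i j (l : K) : (m <= N)%N ->
  i \in last_levels eta m -> j \in last_levels eta m -> y i = l *: y j -> i = j.
Proof.
move=> mN im jm E; have [jm' _] := last_levelsP _ _ _ jm.
case: m => [|m] // in mN im jm jm' *; apply/eqP.
have [c [_ _ _ /(_ (Ordinal mN))[_ _ h]]] := yP.
by apply/negP => /negP nij; case: (h _ _ im jm nij l).
Qed.

Lemma level_complete k a : homogeneous act a -> poisson_prime_in pb (stage k.+1) a ->
  exists2 j, j \in last_levels eta k.+1 & exists2 l : K, l != 0 & a = l *: y j.
Proof. by case: yP => c [_ _ _ /(_ k)[_ h _]]; apply: h. Qed.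

Lemma y_stage k : y k \in stage k.+1. Proof. by case: (y_prime k). Qed.
Lemma y_neq0 k : y k != 0. Proof. by case: (y_prime k). Qed.

Lemma pred_prime k j : eta_pred eta k = Some j -> poisson_prime_in pb (stage k) (y j).
Proof. by move/eta_pred_level; apply: level_prime; apply: ltnW. Qed.

Lemma lead_stage k : lead k \in stage k.
Proof.
rewrite /lead; case E : (eta_pred eta k) => [j|]; last exact: rpred1.
by case: (pred_prime E).
Qed.

Lemma lead_neq0 k : lead k != 0.
Proof. by rewrite /lead; case: eta_pred => [j|]; rewrite ?y_neq0 ?oner_neq0. Qed.

Lemma lead_homogeneous k : homogeneous act (lead k).
Proof.
rewrite /lead; case: eta_pred => [j|]; first exact: y_homogeneous.
by move=> h hh; exists 1; rewrite (cgl_act1 cgl) // scale1r.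
Qed.

Lemma lead_normal k : pnormal k (lead k).
Proof.
rewrite /lead; case E : (eta_pred eta k) => [j|].
  exact: poisson_prime_normal (pred_prime E).
by rewrite -mpolyC1; apply: (pnormalC cgl).
Qed.

Lemma tailP k : tail k \in stage k /\ homogeneous act (tail k).
Proof.
have [c [cP yE' _ _]] := yP; rewrite /tail /lead yE'.
case E : (eta_pred eta k) => [j|].
  by rewrite opprB addrC subrK; apply: cP; rewrite E.
rewrite mul1r subrr; split; first exact: rpred0.
by move=> h hh; exists 0; rewrite (cgl_act0 cgl) // scaler0.
Qed.

Lemma tail_None k : eta_pred eta k = None -> tail k = 0.
Proof. by have [c [_ yE' _ _]] := yP; move=> E; rewrite /tail /lead yE' E mul1r subrr. Qed.

Lemma tail_stage k : tail k \in stage k. Proof. by case: (tailP k). Qed.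

Lemma y_mderiv k : (y k)^`M(w k) = lead k.
Proof.
rewrite yE mderiv_lin // ?rpredN; apply: stage_indep.
  exact: lead_stage.
exact: tail_stage.
Qed.

Lemma y_dep k : y k \notin indep (w k).
Proof.
apply/negP => /mderiv_indep; rewrite y_mderiv => /eqP.
by rewrite (negPf (lead_neq0 k)).
Qed.

(** The tail does not involve x k, so the eigenvalue of y k is that of its
    leading term. *)
Lemma y_act_lead k h (l1 l2 l3 : K) : in_torus h ->
    act h (lead k) = l1 *: lead k -> act h (x k) = l2 *: x k ->
    act h (y k) = l3 *: y k -> l3 = l1 * l2.
Proof.
move=> hh E1 E2 E3; have [ht th] := tailP k; have [l4 E4] := th h hh.
have := @indep_lin K N (w k) l3%:MP (lead k) (tail k) ((l1 * l2)%:MP * lead k)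
  (- (l4%:MP * tail k)).
have hl := stage_indep (lead_stage k); have {}ht := stage_indep ht.
case; rewrite ?rpredN ?rpredM ?indepC ?lead_neq0 //.
  move: E3; rewrite yE (cgl_actB cgl) // (cgl_actM cgl) // E1 E2 E4 -!mul_mpolyC.
  move=> <-; rewrite mpolyCM; ring.
by move=> _ /(mulIf (lead_neq0 k)) /eqP; rewrite mpolyC_eq => /eqP.
Qed.

(** The analogue of [y_act_lead] for the Lie algebra.  The tail inherits the
    eigenvalue of y k. *)
Lemma y_lie k (D : {linear R -> R}) (b m l : K) :
    (forall a b, D (a * b) = D a * b + a * D b) ->
    D (tail k) \in stage k ->
    D (lead k) = b%:MP * lead k -> D (x k) = l%:MP * x k ->
    D (y k) = m%:MP * y k -> m = b + l /\ D (tail k) = m%:MP * tail k.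
Proof.
move=> DM hD E1 E2 E3.
have := @indep_lin K N (w k) m%:MP (lead k) (tail k) ((b + l)%:MP * lead k) (- D (tail k)).
have hl := stage_indep (lead_stage k); have ht := stage_indep (tail_stage k).
case; rewrite ?rpredN ?rpredM ?indepC ?lead_neq0 ?(stage_indep hD) //.
  move: E3; rewrite yE linearB /= DM E1 E2.
  move=> <-; rewrite mpolyCD; ring.
move=> _ /(mulIf (lead_neq0 k)) /eqP; rewrite mpolyC_eq => /eqP ->.
by rewrite opprK => ->.
Qed.

(** The quotient of {y k, a} by y k has degree 0 in x k, and the coefficient
    of x k determines it: it is sigma k a + {lead k, a} / lead k, written here
    without denominators. *)
Lemma y_bracket k a : a \in stage k ->
  lead k * pb (y k) a = y k * (lead k * sigma k a + pb (lead k) a).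
Proof.
move=> ha; have ha' := stage_le (leqnSn k) ha.
have [t tE] := poisson_prime_normal (y_prime k) ha'.
have hl := lead_stage k; have ht := tail_stage k.
have := @indep_lin K N (w k) t (lead k) (tail k)
  (lead k * sigma k a + pb (lead k) a) (lead k * delta k a - pb (tail k) a).
case; rewrite ?lead_neq0 //; try apply: stage_indep => //.
- by rewrite rpredD ?rpredM ?(cgl_sigma_stage cgl) ?(pb_stage cgl).
- by rewrite rpredB ?rpredM ?(cgl_delta_stage cgl) ?(pb_stage cgl).
- rewrite -yE -tE yE (pbBl pbP) (pbMl pbP) (cgl_pbX cgl ha); ring.
by move=> _ E _; rewrite tE -E; ring.
Qed.

(** If tail k = e * lead k, then y k = lead k * (x k - e) contradicts the
    primality of y k. *)
Lemma tail_not_dvd k : eta_pred eta k -> ~ exists e, tail k = e * lead k.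
Proof.
case E : (eta_pred eta k) => [j|] // _ [e eE].
have hl := lead_stage k; have hy := y_dep k.
have yF : y k = (x k - e) * lead k by rewrite yE eE; ring.
have he : x k - e \in stage k.+1.
  by apply: (stage_divisor (b := lead k)); rewrite -yF ?y_stage ?y_neq0.
have := poisson_prime_dvdM (y_prime k) he (stage_le (leqnSn k) hl) (c := 1).
case; first by rewrite mul1r.
  case=> d dE; have e0 : x k - e != 0.
    by have := y_neq0 k; rewrite yF; apply: contraNneq => ->; rewrite mul0r.
  have : d * lead k = 1.
    by apply: (mulfI e0); rewrite mulr1 {2}dE yF; ring.
  by rewrite /lead E; apply: poisson_prime_nunit (pred_prime E).
case=> d dE; case/negP: hy; apply: (@indep_divisor _ _ _ _ d); rewrite mulrC -dE.
  exact: stage_indep.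
exact: lead_neq0.
Qed.

Lemma lie_data k : exists (D : {linear R -> R}) (lam b : K),
  [/\ lam != 0, forall a b, D (a * b) = D a * b + a * D b,
      {in stage k, sigma k =1 D},
      forall a, homogeneous act a -> exists l : K, D a = l%:MP * a
    & [/\ D (x k) = lam%:MP * x k, D (lead k) = b%:MP * lead k
         & D (tail k) = (b + lam)%:MP * tail k]].
Proof.
have [D [lam [l0 DM sD DX Dh]]] := cgl_lie cgl k; exists D, lam.
have [b bE] := Dh _ (lead_homogeneous k); have [m mE] := Dh _ (y_homogeneous k).
have hD : D (tail k) \in stage k.
  by rewrite -sD ?tail_stage // (cgl_sigma_stage cgl) ?tail_stage.
by exists b; have [<- tE] := y_lie DM hD bE DX mE.
Qed.

Lemma lead_bracket k (D : {linear R -> R}) (b : K) :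
    {in stage k, sigma k =1 D} -> D (lead k) = b%:MP * lead k ->
  pb (y k) (lead k) = b%:MP * lead k * y k.
Proof.
move=> sD bE; apply: (mulfI (lead_neq0 k)).
by rewrite y_bracket ?lead_stage // (pbxx pbP) addr0 sD ?lead_stage // bE; ring.
Qed.

Lemma tail_bracket k (D : {linear R -> R}) (lam b : K) :
    {in stage k, sigma k =1 D} -> D (lead k) = b%:MP * lead k ->
    D (tail k) = (b + lam)%:MP * tail k ->
  pb (y k) (tail k)
    = y k * ((b + lam)%:MP * tail k + pb (lead k) (x k) + b%:MP * y k).
Proof.
move=> sD bE tE; apply: (mulfI (lead_neq0 k)).
rewrite y_bracket ?tail_stage // sD ?tail_stage // tE.
rewrite {2}/tail (pbBr pbP) (pbMr pbP) (pbxx pbP) (pb_anti pbP (lead k) (y k)).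
by rewrite (lead_bracket sD bE); ring.
Qed.

(** A Poisson-prime that has a successor stops being Poisson-normal when this
    successor is adjoined.  Otherwise, evaluating {y k, tail k} with
    [tail_bracket] and by the Leibniz rule gives lam * tail k ^ 2 = 0 modulo
    the prime lead k, which does not divide tail k. *)
Lemma lead_not_normal k g : eta_pred eta k -> pb (lead k) (x k) <> g * lead k.
Proof.
move=> hk gE; have [D [lam [b [l0 DM sD _ [xE bE tE]]]]] := lie_data k.
have E : pb (y k) (tail k) = lead k * pb (x k) (tail k) + pb (lead k) (tail k) * x k.
  by rewrite [in LHS]yE (pbBl pbP) (pbMl pbP) (pbxx pbP); ring.
have E2 : pb (lead k) (tail k) = lead k * (pb (lead k) (x k) + b%:MP * y k).
  rewrite /tail (pbBr pbP) (pbMr pbP) (pbxx pbP) (pb_anti pbP (lead k) (y k)).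
  by rewrite (lead_bracket sD bE); ring.
move: E; rewrite (tail_bracket sD bE tE) E2 gE mpolyCD => E.
pose e := (x k * ((b%:MP + lam%:MP) * tail k + g * lead k + b%:MP * y k)
  - tail k * (g + b%:MP * x k) - pb (x k) (tail k)
  - (g * lead k + b%:MP * y k) * x k).
have {E} E : lam%:MP * (tail k * tail k) = e * lead k.
  apply/eqP; rewrite -subr_eq0 -(subrr (lead k * pb (x k) (tail k)
     + lead k * (g * lead k + b%:MP * y k) * x k)) -{2}E /e yE; apply/eqP; ring.
have [j jE] : exists j, eta_pred eta k = Some j by case: (eta_pred eta k) hk => // j; exists j.
have ht := tail_stage k.
have := poisson_prime_dvdM (pred_prime jE) ht ht (c := lam^-1%:MP * e).
have lE : lead k = y j by rewrite /lead jE.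
case; first by rewrite -lE -mulrA -E mulrA -mpolyCM mulVf // mpolyC1 mul1r.
  by rewrite -lE => h; apply: (tail_not_dvd hk h).
by rewrite -lE => h; apply: (tail_not_dvd hk h).
Qed.

(** Both sides are derivations in u.  They vanish on the previous stage, the
    right one by [y_bracket], and agree at x k, where the contributions of b
    cancel and only the eigenvalue lam of x k survives.  The right side is a
    multiple of u when u is homogeneous and Poisson-normal. *)
Lemma euler_identity k (D : {linear R -> R}) (lam b : K) u :
    (forall a b, D (a * b) = D a * b + a * D b) ->
    {in stage k, sigma k =1 D} -> D (x k) = lam%:MP * x k ->
    D (lead k) = b%:MP * lead k -> D (tail k) = (b + lam)%:MP * tail k ->
    u \in stage k.+1 ->
  lam%:MP * y k ^+ 2 * u^`M(w k)
    = y k * lead k * D u + y k * pb (lead k) u - lead k * pb (y k) u.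
Proof.
move=> DM sD xE bE tE hu; apply/eqP; rewrite -subr_eq0; apply/eqP.
pose E v := lam%:MP * y k ^+ 2 * v^`M(w k) -
  (y k * lead k * D v + y k * pb (lead k) v - lead k * pb (y k) v).
apply: (derivation_on_stage (E := E) (S := fun v => v = 0) (w := w) (m := k.+1)) => //.
- move=> l a c; rewrite /E !linearP /= !(pb_linr pbP) -!mul_mpolyC; ring.
- by move=> a c; rewrite /E mderivM DM !(pbMr pbP); ring.
- by move=> a c -> ->; rewrite addr0.
- by move=> a c _ ->; rewrite mulr0.
move=> i; rewrite ltnS leq_eqVlt => /orP[/eqP/val_inj ->|ik]; rewrite /E mderivX mnm1E.
  rewrite eqxx -[X in (X - _)%MM]add0m addmK scale1r mpolyX0 mulr1.
  have -> : lead k * pb (y k) (x k) = pb (y k) (tail k) - b%:MP * lead k * y k * x k.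
    rewrite /tail (pbBr pbP) (pbMr pbP) (pbxx pbP) (lead_bracket sD bE); ring.
  rewrite (tail_bracket sD bE tE) xE /tail mpolyCD; ring.
rewrite (inj_eq perm_inj) (_ : (i == k) = false) ?scale0r; last first.
  by apply: contraTF ik => /eqP ->; rewrite ltnn.
by have h := stageX K w ik; rewrite (y_bracket h) sD // ; ring.
Qed.

(** The exponent f is that of the predecessor of k, and arbitrary
    when lead k = 1. *)
Lemma prod_levels_lead k (e : 'I_N -> nat) : exists f : nat,
  \prod_(i in last_levels eta k) y i ^+ e i
  = lead k ^+ f * \prod_(i in last_levels eta k | Some i != eta_pred eta k) y i ^+ e i.
Proof.
rewrite /lead; case E : (eta_pred eta k) => [j|]; last first.
  by exists 0%N; rewrite expr0 mul1r; apply: eq_bigl => i; rewrite andbT.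
by exists (e j); rewrite (bigD1 j) //=; apply: eta_pred_level.
Qed.

Lemma pnormal_prod m (I : finType) (P : pred I) (F : I -> R) :
  (forall z, P z -> pnormal m (F z)) -> pnormal m (\prod_(i | P i) F i).
Proof.
move=> h; apply: (big_ind (pnormal m)) => //; last by move=> a b; apply: (pnormalM cgl).
by rewrite -mpolyC1; apply: (pnormalC cgl).
Qed.

Lemma pnormalX m u n : pnormal m u -> pnormal m (u ^+ n).
Proof.
move=> hu; elim: n => [|n IH]; first by rewrite expr0 -mpolyC1; apply: (pnormalC cgl).
by rewrite exprS; apply: (pnormalM cgl).
Qed.

Lemma homogeneousX u n : homogeneous act u -> homogeneous act (u ^+ n).
Proof.
move=> hu h hh; have [l lE] := hu h hh; exists (l ^+ n).
elim: n => [|n IH]; first by rewrite !expr0 (cgl_act1 cgl) // scale1r.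
by rewrite !exprS (cgl_actM cgl) // IH lE -scalerAl -scalerAr scalerA.
Qed.

Lemma factor_out_y k u : u != 0 ->
  exists n v, u = y k ^+ n * v /\ ~ exists d, v = d * y k.
Proof.
have [n] := ubnP (msize u); elim: n u => // n IH u; rewrite ltnS => un u0.
have [[d dE]|nd] := classic (exists d, u = d * y k); last first.
  by exists 0%N, u; rewrite expr0 mul1r.
have d0 : d != 0 by apply: contraNneq u0 => d0; rewrite dE d0 mul0r.
have y1 : (1 < msize (y k))%N.
  rewrite ltnNge; apply/negP => /msize1_polyC yC.
  by move: (y_dep k); rewrite yC indepC.
have [|//|n' [v [vE nv]]] := IH d.
  apply: leq_trans un; rewrite dE msizeM ?y_neq0 //.
  by case: (msize (y k)) y1 => [|[|s]] // _; rewrite !addnS /= ltnS leq_addr.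
by exists n'.+1, v; split=> //; rewrite dE vE exprS; ring.
Qed.

Hypothesis charK0 : [pchar K] =i pred0.

Lemma natrS_neq0 n : n.+1%:R != 0 :> K.
Proof. by have /pcharf0P -> := charK0. Qed.

Lemma mderiv_eq0_indep (i : 'I_N) a : a^`M(i) = 0 -> a \in indep i.
Proof.
move=> da; apply/indepP => e; rewrite mcoeff_msupp => ae; apply/eqP.
apply: contraNT ae; rewrite -lt0n => ei.
have := mcoeff_mderiv i a (e - U_(i))%MM; rewrite da mcoeff0 submK; last first.
  by apply/mnm_lepP => j; rewrite mnm1E; case: eqP => // <-.
move/esym/eqP; rewrite -mulr_natr mulf_eq0 (negPf (natrS_neq0 _)) orbF.
by [].
Qed.

(** The total degree of a derivative is smaller. *)
Lemma mderiv_eigen (i : 'I_N) a g : a^`M(i) = g * a -> a^`M(i) = 0.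
Proof.
move=> E; apply/eqP; apply: contraT => da0.
have [g0 a0] : g != 0 /\ a != 0.
  by apply/norP; rewrite -mulf_eq0 -E.
have : (msize a^`M(i) < msize a)%N.
  rewrite -(prednK (n := msize a)) ?ltnS; last by rewrite lt0n msize_poly_eq0.
  rewrite msizeE; apply/bigmax_leqP_seq => e; rewrite mcoeff_msupp mcoeff_mderiv => he _.
  have : (e + U_(i))%MM \in msupp a.
    by rewrite mcoeff_msupp; apply: contraNneq he => ->; rewrite mul0rn.
  by move/msize_mdeg_lt; rewrite mdegD mdeg1 addn1; case: (msize a).
rewrite E msizeM //; have : (0 < msize g)%N by rewrite lt0n msize_poly_eq0.
by case: (msize g) => // s _; rewrite addSn /= ltnNge leq_addl.
Qed.

Lemma stage_quot m a b : b != 0 -> a * b \in stage m -> a \in stage m.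
Proof.
move=> b0 hab; have [->|a0] := eqVneq a 0; first exact: rpred0.
by apply: stage_divisor hab _; rewrite mulf_neq0.
Qed.

(** By [euler_identity], y k ^ 2 times dv/dx is a multiple G * v of v.  As
    y k is prime and does not divide v, its square divides G; hence v divides
    dv/dx, which must vanish. *)
Lemma normal_not_dvd_stage k v : v \in stage k.+1 -> v != 0 -> homogeneous act v ->
    pnormal k.+1 v -> (~ exists d, v = d * y k) ->
  v \in stage k.
Proof.
move=> hv v0 hom nv nd; have [D [lam [b [l0 DM sD Dh [xE bE tE]]]]] := lie_data k.
have hl := stage_le (leqnSn k) (lead_stage k); have hy := y_stage k.
have [al alE] := Dh _ hom; have [g1 g1E] := nv _ hl; have [g2 g2E] := nv _ hy.
have hg1 : g1 \in stage k.+1 by apply: (stage_quot v0); rewrite -g1E (pb_stage cgl).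
have hg2 : g2 \in stage k.+1 by apply: (stage_quot v0); rewrite -g2E (pb_stage cgl).
pose G := y k * lead k * al%:MP - y k * g1 + lead k * g2.
have hG : G \in stage k.+1 by rewrite rpredD ?rpredB ?rpredM ?stageC.
have GE : G * v = (lam%:MP * y k * v^`M(w k)) * y k.
  have := euler_identity DM sD xE bE tE hv.
  rewrite alE (pb_anti pbP _ v) (pb_anti pbP _ v) g1E g2E expr2 /G => h.
  transitivity (lam%:MP * (y k * y k) * v^`M(w k)); last by ring.
  rewrite h; ring.
case: (poisson_prime_dvdM (y_prime k) hG hv GE) => // -[G1 G1E].
have hG1 : G1 \in stage k.+1 by apply: (stage_quot (y_neq0 k)); rewrite -G1E.
have G1v : G1 * v = (lam%:MP * v^`M(w k)) * y k.
  by apply: (mulIf (y_neq0 k)); transitivity (G * v); [rewrite G1E|rewrite GE]; ring.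
case: (poisson_prime_dvdM (y_prime k) hG1 hv G1v) => // -[G2 G2E].
have dv : v^`M(w k) = (lam^-1%:MP * G2) * v.
  have -> : lam^-1%:MP * G2 * v = lam^-1%:MP * (G2 * v) by ring.
  have -> : G2 * v = lam%:MP * v^`M(w k).
    by apply: (mulIf (y_neq0 k)); rewrite -G1v G2E; ring.
  by rewrite mulrA -mpolyCM mulVf // mpolyC1 mul1r.
by apply: (stage_drop hv); apply: mderiv_eq0_indep; apply: mderiv_eigen dv.
Qed.

Lemma stage0 a : a \in stage 0%N -> a = (a@_0)%:MP.
Proof.
move=> /stageP ha; apply/mpolyP => e; rewrite mcoeffC.
have [<-|/eqP e0] := eqVneq 0%MM e; first by rewrite mulr1.
rewrite mulr0; apply/eqP; apply: contra_notT e0; rewrite -mcoeff_msupp => he.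
apply/mnmP => i; rewrite mnm0E; have := ha ((w^-1)%g i) isT; rewrite permKV.
by move/indepP/(_ e he) => ->.
Qed.

(** Induction on the stage.  Removing the factors y k leaves an element of
    the previous stage, still Poisson-normal in the larger one; since
    {lead k, x k} is not a multiple of lead k, the predecessor of k does not
    occur in it. *)
Lemma normal_factor m u : (m <= N)%N -> u \in stage m -> u != 0 ->
    homogeneous act u -> pnormal m u ->
  exists (kappa : K) (e : 'I_N -> nat), kappa != 0 /\
    u = kappa%:MP * \prod_(i in last_levels eta m) y i ^+ e i.
Proof.
elim: m u => [|m IH] u mN hu u0 hom nu.
  exists (u@_0), (fun=> 0%N); rewrite last_levels0 big_set0 mulr1 -(stage0 hu).
  by split=> //; apply: contraNneq u0 => h; rewrite (stage0 hu) h mpolyC0.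
pose k := Ordinal mN; have [n [v [uE nd]]] := factor_out_y k u0.
have v0 : v != 0 by apply: contraNneq u0 => h; rewrite uE h mulr0.
have yn0 : y k ^+ n != 0 by rewrite expf_neq0 ?y_neq0.
have hv : v \in stage k.+1 by apply: (stage_quot yn0); rewrite mulrC -uE.
have homv : homogeneous act v.
  apply: (homogeneous_div cgl yn0); first exact: homogeneousX (y_homogeneous k).
  by rewrite -uE.
have nv : pnormal k.+1 v.
  apply: (pnormal_div cgl yn0); last by rewrite -uE.
  by apply: pnormalX; apply: poisson_prime_normal (y_prime k).
have hvk := normal_not_dvd_stage hv v0 homv nv nd.
have nvk : pnormal k v by move=> a ha; apply: nv; apply: stage_le ha.
have [kap [e [kap0 vE]]] := IH v (ltnW mN) hvk v0 homv nvk.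
have [f fE] := prod_levels_lead k e.
set rest := \prod_(i in last_levels eta k | _) _ in fE.
have nrest : pnormal k.+1 rest.
  apply: pnormal_prod => i /andP[ik ip]; apply: pnormalX.
  apply: poisson_prime_normal; apply: level_prime => //.
  by rewrite last_levelsS in_setU1 inE ik ip orbT.
(* A positive power of the predecessor would be Poisson-normal, as the
   quotient of v by the other, Poisson-normal, factors. *)
have lf1 : lead k ^+ f = 1.
  case: f fE => // f fE; case E : (eta_pred eta k) => [j|]; last first.
    by rewrite /lead E expr1n.
  have vF : v = (kap%:MP * rest) * lead k ^+ f.+1 by rewrite vE fE; ring.
  have kr0 : kap%:MP * rest != 0.
    by apply: contraNneq v0; rewrite vF => ->; rewrite mul0r.
  have nlf : pnormal k.+1 (lead k ^+ f.+1).
    apply: (pnormal_div cgl kr0); first by apply: (pnormalM cgl) nrest; apply: (pnormalC cgl).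
    by rewrite -vF.
  have [g gE] := nlf _ (stageX K w (ltnSn k)).
  case: (@lead_not_normal k ((f.+1%:R)^-1%:MP * g)); first by rewrite E.
  have h : f.+1%:R * pb (lead k) (x k) = g * lead k.
    apply: (mulIf (expf_neq0 f (lead_neq0 k))).
    by rewrite -[RHS]mulrA -exprS -gE (pbXl pbP) mulrAC.
  by rewrite -mulrA -h mulrA -mpolyC_nat -mpolyCM mulVf ?natrS_neq0 // mpolyC1 mul1r.
exists kap, (fun i => if i == k then n else e i); split=> //.
have -> : last_levels eta m.+1 = last_levels eta k.+1 by [].
rewrite last_levelsS big_setU1 /= ?eqxx; last first.
  by rewrite inE negb_and; apply/orP; left; apply/negP => /last_levelsP[]; rewrite ltnn.
rewrite uE vE fE lf1 mul1r mulrCA; congr (_ * (_ * _)).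
rewrite /rest (eq_bigl (fun i => (i \in last_levels eta k) && (Some i != eta_pred eta k)));
  last by move=> i; rewrite inE.
apply: eq_bigr => i /andP[/last_levelsP[ik _] _].
by case: eqP ik => // ->; rewrite ltnn.
Qed.

End Primes.

(** * Comparison of two presentations *)

Section CommonStages.
Variables (K : fieldType) (N : nat).
Local Notation R := {mpoly K[N]}.
Implicit Types (a b c q : R) (i j : 'I_N).

Lemma stage_sub (w w' : 'S_N) m a :
    (forall i, (m <= i)%N -> exists2 j : 'I_N, (m <= j)%N & w' i = w j) ->
  a \in stage w m -> a \in stage w' m.
Proof. by move=> h /stageP ha; apply/stageP => i /h[j mj ->]; apply: ha. Qed.

Lemma stage_agree (w w' : 'S_N) m :
  (forall i, (i < m)%N -> w i = w' i) -> @stage K N w m =i stage w' m.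
Proof.
move=> h a; apply/idP/idP; apply: stage_sub => i mi.
  exists ((w^-1)%g (w' i)); last by rewrite permKV.
  rewrite leqNgt; apply/negP => ji; have := h _ ji; rewrite permKV => /perm_inj.
  by move: ji => /[swap] <-; rewrite ltnNge mi.
exists ((w'^-1)%g (w i)); last by rewrite permKV.
rewrite leqNgt; apply/negP => ji; have := h _ ji; rewrite permKV => /perm_inj.
by move: ji => /[swap] ->; rewrite ltnNge mi.
Qed.

Lemma poisson_prime_eq (pb : R -> R -> R) (B B' : {pred R}) c :
  B =i B' -> poisson_prime_in pb B c -> poisson_prime_in pb B' c.
Proof.
move=> BB [hc c0 hn n1 hp].
have dd a : divides_in B c a <-> divides_in B' c a.
  by split=> -[b hb ->]; exists b; rewrite // ?BB // -BB.
split=> //; first by rewrite -BB.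
- by move=> a ha; apply/dd; apply: hn; rewrite BB.
- by move/dd.
move=> a b ha hb /dd h; have [||/dd|/dd] := hp a b _ _ h; rewrite ?BB //; tauto.
Qed.

End CommonStages.

Section TwoPresentations.
Variables (K : fieldType) (N r : nat).
Local Notation R := {mpoly K[N]}.
Local Notation stage := (@stage K N).
Variables (pb : R -> R -> R) (act : {ffun 'I_r -> K} -> R -> R).
Variables (w w' : 'S_N) (sigma delta sigma' delta' : 'I_N -> R -> R).
Hypothesis cgl : poisson_CGL pb act w sigma delta.
Hypothesis cgl' : poisson_CGL pb act w' sigma' delta'.
Variables (eta eta' : 'I_N -> int) (y y' : 'I_N -> R).
Hypothesis yP : homogeneous_primes pb act w eta y.
Hypothesis y'P : homogeneous_primes pb act w' eta' y'.
Implicit Types (i j k : 'I_N).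

Definition agree m := forall j, (j < m)%N ->
  y j = y' j /\ eta_pred eta j = eta_pred eta' j.

Lemma agree_levels m : agree m -> last_levels eta m = last_levels eta' m.
Proof.
move=> am; apply/setP => j; apply/last_levelsP/last_levelsP => -[jm h]; split=> // i im.
  by have [_ <-] := am i im; apply: h.
by have [_ ->] := am i im; apply: h.
Qed.

(** A lead is 1 or one of the pairwise non-proportional Poisson-primes of the
    common stage, and such a prime is not a scalar. *)
Lemma agree_lead k (l : K) : agree k -> lead eta y k = l%:MP * lead eta' y' k ->
  l = 1 /\ eta_pred eta k = eta_pred eta' k.
Proof.
move=> ak; have kN := ltnW (ltn_ord k); rewrite /lead.
case E : (eta_pred eta k) => [j|]; case E' : (eta_pred eta' k) => [j'|].
- have hj := eta_pred_level E; have hj' := eta_pred_level E'.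
  have [j'k _] := last_levelsP _ _ _ hj'; have [<- _] := ak _ j'k.
  rewrite -(agree_levels ak) in hj'; rewrite mul_mpolyC => F.
  have jj := level_inj yP kN hj hj' F; rewrite jj; split=> //.
  apply/eqP; rewrite -subr_eq0; move/eqP: F; rewrite jj -subr_eq0 -[X in X - _]scale1r.
  by rewrite -scalerBl scaler_eq0 (negPf (y_neq0 yP _)) orbF -opprB oppr_eq0.
- rewrite mulr1 => F; case: (poisson_prime_nunit (pred_prime yP E) (c := l^-1%:MP)).
  have l0 : l != 0.
    by have := y_neq0 yP j; rewrite F mpolyC_eq0.
  by rewrite F -mpolyCM mulVf // mpolyC1.
- by move/esym; case/(poisson_prime_nunit (pred_prime y'P E')).
- by rewrite mulr1 => /esym/eqP; rewrite -mpolyC1 mpolyC_eq => /eqP ->.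
Qed.

(** y k is a homogeneous Poisson-prime of the common stage, so it occurs up to
    a scalar among those listed by the other presentation. *)
Lemma y_multiple k : stage w k.+1 =i stage w' k.+1 ->
  exists2 j : 'I_N, (j <= k)%N & exists2 l : K, l != 0 & y k = l%:MP * y' j.
Proof.
move=> ss; have := level_complete y'P (y_homogeneous yP k)
  (poisson_prime_eq ss (y_prime yP k)).
case=> j /last_levelsP[jk _] [l l0 yl]; exists j => //; exists l => //.
by rewrite mul_mpolyC.
Qed.

(** In [y_multiple], y j cannot be a multiple of an earlier y', which lies in
    a smaller stage; so it is a multiple of y' j, and the scalar and the
    predecessor are found by comparing the coefficients of the last variable. *)
Lemma presentations_agree m : (m <= N)%N ->
  (forall i, (i < m)%N -> w i = w' i) -> agree m.
Proof.
elim: m => [|m IH] mN ww j; first by [].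
have {}IH : agree m by apply: IH => [|i im]; [apply: ltnW|apply: ww; apply: ltnW].
rewrite ltnS leq_eqVlt => /orP[/eqP jm|]; last exact: IH.
rewrite -jm in IH ww mN.
have wj := ww j (ltnSn j).
have ss : stage w j =i stage w' j by apply: stage_agree => i ij; apply: ww; apply: ltnW.
have [j' j'j [l l0 yl]] := y_multiple (stage_agree ww).
move: j'j; rewrite leq_eqVlt => /orP[/eqP/val_inj jj|j'j]; last first.
  case/negP: (y_dep cgl yP j); apply: stage_indep.
  by rewrite yl ss rpredM ?stageC //; apply: stage_le j'j _; apply: (y_stage y'P).
rewrite jj in yl.
have lE : lead eta y j = l%:MP * lead eta' y' j.
  rewrite -(y_mderiv cgl yP) yl mderiv_mulC; congr (_ * _).
  by rewrite wj; apply: (y_mderiv cgl' y'P).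
have [l1 pE] := agree_lead IH lE.
by rewrite yl l1 mpolyC1 mul1r.
Qed.

End TwoPresentations.

(** * The exchange relation *)

Section Exchange.
Variables (K : fieldType) (N r : nat).
Local Notation R := {mpoly K[N]}.
Local Notation stage := (@stage K N).
Variables (pb : R -> R -> R) (act : {ffun 'I_r -> K} -> R -> R).
Variables (sigma delta sigma' delta' : 'I_N -> R -> R).
Variables (k k1 : 'I_N).
Hypothesis k1E : k1 = k.+1 :> nat.
Local Notation std := (1%g : 'S_N).
Local Notation sw := (tperm k k1 : 'S_N).
Hypothesis cgl : poisson_CGL pb act std sigma delta.
Hypothesis cgl' : poisson_CGL pb act sw sigma' delta'.
Variables (eta eta' : 'I_N -> int) (y y' : 'I_N -> R).
Hypothesis yP : homogeneous_primes pb act std eta y.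
Hypothesis y'P : homogeneous_primes pb act sw eta' y'.
Hypothesis eta_k : eta k = eta k1.
Local Notation x := ('X_k : R).
Local Notation z := ('X_k1 : R).
Local Notation q := (lead eta y k).
Local Notation pbP := (cgl_pb cgl).
Implicit Types (a b c : R) (i j : 'I_N) (m : nat).

Lemma swap_below i : (i < k)%N -> std i = sw i.
Proof.
move=> ik; rewrite perm1 tpermD //; apply: contraTneq ik => <-; rewrite ?ltnn //.
by rewrite k1E ltnNge leqnSn.
Qed.

Lemma swap_stage m : (m <= k)%N || (k1 < m)%N -> stage std m =i stage sw m.
Proof.
have swlt i : (m <= k)%N || (k1 < m)%N -> (m <= i)%N -> (m <= sw i)%N.
  move=> h mi; case: tpermP => [ik|ik1|//]; rewrite ?ik ?ik1 in mi *.
    by rewrite k1E; apply: leq_trans mi _.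
  by move: h; rewrite ltnNge mi orbF.
move=> h a; apply/idP/idP; apply: stage_sub => i mi.
  by exists (sw i); rewrite ?perm1 ?swlt.
by exists (sw i); rewrite ?swlt // tpermK perm1.
Qed.

Lemma swap_stage_le a : a \in stage sw k -> a \in stage std k.
Proof. by rewrite swap_stage ?leqnn. Qed.

Lemma swap_indep_x m a : (m <= k1)%N -> a \in stage sw m -> a \in indep k.
Proof. by move=> mk /stageP/(_ k1 mk); rewrite tpermR. Qed.

Lemma stage_meet a : a \in stage std k.+1 -> a \in stage sw k.+1 -> a \in stage std k.
Proof.
move=> h h'; apply: stage_drop h _; rewrite perm1.
by apply: swap_indep_x h'; rewrite k1E.
Qed.

Lemma swap_agree : agree eta eta' y y' k.
Proof. exact (presentations_agree cgl cgl' yP y'P (ltnW (ltn_ord k)) swap_below). Qed.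

Lemma pred_k1 : eta_pred eta k1 = Some k.
Proof.
apply/eqP/eta_predP; split=> //; first by rewrite k1E.
by move=> i; rewrite k1E ltnS.
Qed.

Lemma lead_k1 : lead eta y k1 = y k.
Proof. by rewrite /lead pred_k1. Qed.

(** Partial derivatives commute, so this coefficient of x * z is also
    accessible from the second presentation. *)
Lemma dx_dz_y_k1 : (y k1)^`M(k1)^`M(k) = q.
Proof.
have := y_mderiv cgl yP k1; rewrite perm1 lead_k1 => ->.
by have := y_mderiv cgl yP k; rewrite perm1.
Qed.

Lemma y_k1_indep : y k1 \notin indep k.
Proof.
apply/negP => /mderiv_indep h; have := dx_dz_y_k1; rewrite mderiv_comm h mderiv0.
by move/esym/eqP; rewrite (negPf (lead_neq0 yP k)).
Qed.

(** y k1 is a multiple of y' j for some j <= k1, and involves x, which the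
    earlier y' do not; so j = k1.  Its coefficient q of x * z is nonzero,
    which forces the lead of y' k1 to involve z, hence to be y' k; the
    coefficient then compares q with the lead of y' k. *)
Lemma exchange_data :
  [/\ y k1 = y' k1, eta_pred eta' k1 = Some k,
      eta_pred eta k = eta_pred eta' k & q = lead eta' y' k].
Proof.
have ss : stage std k1.+1 =i stage sw k1.+1 by apply: swap_stage; rewrite ltnSn orbT.
have [j jk1 [l l0 yl]] := y_multiple yP y'P ss.
have jE : j = k1.
  move: jk1; rewrite leq_eqVlt => /orP[/eqP/val_inj //|]; rewrite k1E ltnS => jk.
  case/negP: y_k1_indep; apply: (swap_indep_x (m := k.+1)); rewrite ?k1E //.
  by rewrite yl rpredM ?stageC //; apply: stage_le (y_stage y'P j); rewrite ltnS.
rewrite {}jE in yl.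
have y'1 : (y' k1)^`M(k) = lead eta' y' k1.
  by have := y_mderiv cgl' y'P k1; rewrite tpermR.
have y'0 : (y' k)^`M(k1) = lead eta' y' k.
  by have := y_mderiv cgl' y'P k; rewrite tpermL.
have qE : q = l%:MP * (lead eta' y' k1)^`M(k1).
  by rewrite -dx_dz_y_k1 mderiv_comm yl !mderiv_mulC y'1.
have pE : eta_pred eta' k1 = Some k.
  case E : (eta_pred eta' k1) => [i|]; last first.
    have /eqP[] := lead_neq0 yP k; rewrite qE /lead E -mpolyC1 mderivC.
    exact: mulr0.
  move/eqP/eta_predP: (E) => [ik _ _].
  move: ik; rewrite k1E ltnS leq_eqVlt => /orP[/eqP/val_inj -> //|ik].
  have /eqP[] := lead_neq0 yP k; rewrite qE /lead E mderiv_indep ?mulr0 //.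
  have := stage_indep (stage_le ik (y_stage y'P i)); by rewrite tpermL.
have qE' : q = l%:MP * lead eta' y' k by rewrite qE /lead pE y'0.
have [l1 pE'] := agree_lead yP y'P swap_agree qE'.
by split=> //; [rewrite yl l1 mpolyC1 mul1r|rewrite qE' l1 mpolyC1 mul1r].
Qed.

(** The element to be identified with kappa times a product of
    Poisson-primes. *)
Definition exchange_rest : R := y k * y' k - q * y k1.

(** Expanding y k1 in the first presentation shows that z does not occur,
    and in the second one, below, that x does not. *)
Lemma exchange_restE : exchange_rest = q * tail std eta y k1 - y k * tail sw eta' y' k.
Proof.
have [_ _ _ qE] := exchange_data; rewrite /exchange_rest.
have -> : y' k = q * z - tail sw eta' y' k.
  by have := yE sw eta' y' k; rewrite -qE tpermL.
have -> : y k1 = y k * z - tail std eta y k1.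
  by have := yE std eta y k1; rewrite lead_k1 perm1.
ring.
Qed.

Lemma exchange_restE' : exchange_rest = q * tail sw eta' y' k1 - y' k * tail std eta y k.
Proof.
have [yE1 pE _ qE] := exchange_data; rewrite /exchange_rest yE1.
have -> : y' k1 = y' k * x - tail sw eta' y' k1.
  by have := yE sw eta' y' k1; rewrite tpermR /lead pE.
have -> : y k = q * x - tail std eta y k.
  by have := yE std eta y k; rewrite perm1.
ring.
Qed.

Lemma exchange_rest_stage : exchange_rest \in stage std k.
Proof.
have [_ _ _ qE] := exchange_data.
have hq := lead_stage yP k; have hq' := lead_stage y'P k.
have hc := tail_stage cgl yP k; have hc' := tail_stage cgl' y'P k.
have hd := tail_stage cgl yP k1; have hd' := tail_stage cgl' y'P k1.
rewrite k1E in hd hd'.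
apply: stage_meet.
  rewrite exchange_restE rpredB ?rpredM ?(y_stage yP) //; first exact: stage_le hq.
  by apply: (stage_le (leqnSn k)); apply: swap_stage_le.
rewrite exchange_restE' qE rpredB ?rpredM ?(y_stage y'P) //; first exact: stage_le hq'.
by apply: (stage_le (leqnSn k)); rewrite -swap_stage ?leqnn.
Qed.

(** Otherwise the prime y k1 would divide y k, which does not involve z, or
    y' k, which does not involve x. *)
Lemma exchange_rest_neq0 : exchange_rest != 0.
Proof.
have [yE1 _ _ _] := exchange_data.
apply/negP; rewrite subr_eq0 => /eqP E.
have ss : stage std k1.+1 =i stage sw k1.+1 by apply: swap_stage; rewrite ltnSn orbT.
have h := y_stage yP k; have h' := y_stage y'P k; rewrite -k1E in h h'.
have H := stage_le (leqnSn k1) h.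
have H' : y' k \in stage std k1.+1 by rewrite ss; apply: stage_le h'.
have no (w : 'S_N) (v : 'I_N -> R) d : v k \in stage w k1 -> v k != 0 ->
    v k1 \notin indep (w k1) -> v k = d * v k1 -> False.
  move=> /stage_indep hv v0 /negP + vE; apply; rewrite vE mulrC in hv v0.
  exact: indep_divisor hv v0.
case: (poisson_prime_dvdM (y_prime yP k1) H H' E) => -[d].
  exact: no h (y_neq0 yP k) (y_dep cgl yP k1).
rewrite yE1; exact: no h' (y_neq0 y'P k) (y_dep cgl' y'P k1).
Qed.

(** y k * y' k and q * y k1 have the same leading term q^2 * x * z, hence the
    same eigenvalues. *)
Lemma exchange_rest_homogeneous : homogeneous act exchange_rest.
Proof.
have [_ _ _ qE] := exchange_data; move=> h hh.
have [l1 E1] := lead_homogeneous cgl yP k hh.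
have [lx Ex] := cgl_homogeneousX cgl k hh.
have [lz Ez] := cgl_homogeneousX cgl k1 hh.
have [ly Ey] := y_homogeneous yP k hh.
have [ly' Ey'] := y_homogeneous y'P k hh.
have [ly1 Ey1] := y_homogeneous yP k1 hh.
have F1 : ly = l1 * lx by apply: (y_act_lead cgl yP) hh E1 _ Ey; rewrite perm1.
have F2 : ly' = l1 * lz.
  by apply: (y_act_lead cgl' y'P (k := k)) hh _ _ Ey'; rewrite -?qE ?tpermL.
have F3 : ly1 = ly * lz.
  by apply: (y_act_lead cgl yP (k := k1)) hh _ _ Ey1; rewrite ?lead_k1 ?perm1.
exists (ly * ly'); rewrite (cgl_actB cgl) // !(cgl_actM cgl) // Ey Ey' Ey1 E1.
rewrite /exchange_rest F3 F2 F1 -!mul_mpolyC !mpolyCM; ring.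
Qed.

(** By [y_bracket], {-, a} multiplies both y k * y' k and q * y k1 by
    sigma k a + sigma k1 a + 2 t, where {q, a} = t * q. *)
Lemma exchange_rest_normal : pnormal pb std k exchange_rest.
Proof.
have [_ _ _ qE] := exchange_data; move=> a ha.
have ha' : a \in stage sw k by rewrite -swap_stage ?leqnn.
have ha1 : a \in stage std k1 by apply: stage_le ha; rewrite k1E.
have [t tE] := lead_normal cgl yP ha.
have sE : sigma' k a = sigma k1 a.
  have h1 := cgl_pbX cgl ha1; have h2 := cgl_pbX cgl' ha'.
  rewrite perm1 in h1; rewrite tpermL h1 in h2.
  have := congr1 (mderiv k1) h2; rewrite !mderiv_lin //.
  - by have := stage_indep (cgl_sigma_stage cgl' ha'); rewrite tpermL.
  - by have := stage_indep (cgl_delta_stage cgl' ha'); rewrite tpermL.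
  - by have := stage_indep (cgl_sigma_stage cgl ha1); rewrite perm1.
  - by have := stage_indep (cgl_delta_stage cgl ha1); rewrite perm1.
have B1 : pb (y k) a = y k * (sigma k a + t).
  by apply: (mulfI (lead_neq0 yP k)); rewrite (y_bracket cgl yP ha) tE; ring.
have B2 : pb (y' k) a = y' k * (sigma k1 a + t).
  apply: (mulfI (lead_neq0 yP k)); rewrite qE (y_bracket cgl' y'P ha') -qE tE sE; ring.
have B3 : pb (y k1) a = y k1 * (sigma k1 a + sigma k a + t).
  apply: (mulfI (y_neq0 yP k)).
  have := y_bracket cgl yP ha1; rewrite lead_k1 => ->; rewrite B1; ring.
exists (sigma k a + sigma k1 a + t + t).
rewrite (pbBl pbP) !(pbMl pbP) B1 B2 B3 tE /exchange_rest; ring.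
Qed.

(** Modulo q the element is the product of the tails of y k and y' k, none of
    which is divisible by the prime q. *)
Lemma lead_not_dvd_exchange_rest d : eta_pred eta k -> exchange_rest <> d * q.
Proof.
move=> hk E; have [_ _ pE qE] := exchange_data.
have [j jE] : exists j, eta_pred eta k = Some j by case: (eta_pred eta k) hk => // j; exists j.
have hc := tail_stage cgl yP k; have hc' := swap_stage_le (tail_stage cgl' y'P k).
have cc : tail std eta y k * tail sw eta' y' k
    = (d - tail std eta y k1 + x * tail sw eta' y' k) * y j.
  have -> : y j = q by rewrite /lead jE.
  apply/eqP; rewrite -subr_eq0; apply/eqP; transitivity (exchange_rest - d * q).
    have yk : y k = q * x - tail std eta y k by have := yE std eta y k; rewrite perm1.
    by rewrite exchange_restE {1}yk; ring.
  by rewrite E subrr.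
case: (poisson_prime_dvdM (pred_prime yP jE) hc hc' cc) => -[e eE].
  by apply: (tail_not_dvd cgl yP hk); exists e; rewrite eE /lead jE.
have hk' : eta_pred eta' k by rewrite -pE.
by apply: (tail_not_dvd cgl' y'P hk'); exists e; rewrite -qE eE /lead jE.
Qed.

(** Here y k = x, y' k = z and y k1 = x * z - u, where u denotes
    [exchange_rest].  Since u is the tail of y' k1, it has the same eigenvalue
    as x * z under the Lie algebra element that defines the adjunction of x
    after z; this makes lam * u + c the coefficient of x in an identity whose
    other terms do not involve x. *)
Lemma exchange_rest_const (c : K) : delta k1 x = c%:MP -> eta_pred eta k = None ->
  exists kappa : K, exchange_rest = kappa%:MP.
Proof.
move=> cE p0; have [yE1 pE pE' qE] := exchange_data.
have q1 : q = 1 by rewrite /lead p0.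
have t0 : tail std eta y k = 0 := tail_None yP p0.
have t0' : tail sw eta' y' k = 0 by apply: (tail_None y'P); rewrite -pE'.
have yk : y k = x by have := yE std eta y k; rewrite q1 t0 perm1 subr0 mul1r.
have y'k : y' k = z by have := yE sw eta' y' k; rewrite -qE q1 t0' tpermL subr0 mul1r.
have l'1 : lead eta' y' k1 = z by rewrite /lead pE.
have uE : y k1 = x * z - exchange_rest by rewrite /exchange_rest yk y'k q1; ring.
have tE : tail sw eta' y' k1 = exchange_rest.
  by rewrite exchange_restE' q1 t0; ring.
have [D [lam [b [l0 _ sD _ [_]]]]] := lie_data cgl' y'P k1.
rewrite l'1 tE => zE DuE.
have hu := exchange_rest_stage.
have hz' : z \in stage sw k1 by rewrite -l'1; apply: (lead_stage y'P).
have hu' : exchange_rest \in stage sw k1 by rewrite -tE; apply: (tail_stage cgl' y'P).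
have hx : x \in stage std k1.
  by have := stageX K std (i := k) (m := k1); rewrite perm1 k1E; apply.
have hu1 : exchange_rest \in stage std k1 by apply: stage_le hu; rewrite k1E.
have pxu : pb x exchange_rest = (b + lam)%:MP * exchange_rest * x + delta' k1 exchange_rest.
  by have := cgl_pbX cgl' hu'; rewrite tpermR sD // DuE.
have pxz : pb x z = b%:MP * z * x + delta' k1 z.
  by have := cgl_pbX cgl' hz'; rewrite tpermR sD // zE.
have pzx : pb z x = sigma k1 x * z + c%:MP.
  by have := cgl_pbX cgl hx; rewrite perm1 cE.
have [m mE] : exists m : K, sigma k1 x = m%:MP * x.
  have [D1 [_ [_ _ sD1 _ hD1]]] := cgl_lie cgl k1.
  by rewrite sD1 //; apply: hD1; apply: (cgl_homogeneousX cgl).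
have kk1 : k1 != k by rewrite -val_eqE /= k1E neq_ltn ltnSn orbT.
have idx_z : z \in indep k by apply: indepX; rewrite eq_sym.
have idz_x : x \in indep k1 by apply: indepX.
have idx_u : exchange_rest \in indep k by have := stage_indep hu; rewrite perm1.
have idz_u : exchange_rest \in indep k1 by have := stage_indep hu1; rewrite perm1.
have idx_du : delta' k1 exchange_rest \in indep k.
  by have := stage_indep (cgl_delta_stage cgl' hu'); rewrite tpermR.
have idx_dz : delta' k1 z \in indep k.
  by have := stage_indep (cgl_delta_stage cgl' hz'); rewrite tpermR.
have idz_p : pb x exchange_rest \in indep k1.
  by have := stage_indep (pb_stage cgl hx hu1); rewrite perm1.
have mb : m%:MP * z = - (b%:MP * z).
  have : m%:MP * z * x + c%:MP = - (b%:MP * z) * x + - delta' k1 z.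
    have := pb_anti pbP z x; rewrite pzx pxz mE => h.
    transitivity (m%:MP * x * z + c%:MP); first by ring.
    rewrite h; ring.
  move/(congr1 (mderiv k)); rewrite !mderiv_lin ?rpredN ?rpredM ?indepC //.
have {}mb : m%:MP = - b%:MP :> R.
  by apply: (mulIf (mpolyX_neq0 K k1)); rewrite mb mulNr.
(* Poisson-normality of y k1 against x, compared coefficientwise in z. *)
have [t tyE] : exists t, pb (y k1) x = t * y k1.
  apply: (poisson_prime_normal (y_prime yP k1)).
  by apply: stage_le hx; apply: leqnSn.
have [_ tx tu] : [/\ t \in indep k1, t * x = - (b%:MP * x * x)
    & t * exchange_rest = - (c%:MP * x + pb x exchange_rest)].
  apply: (indep_lin idz_x idz_u _ _ (mpolyX_neq0 K k)).
  - by rewrite rpredN !rpredM ?indepC.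
  - by rewrite rpredD // rpredM ?indepC.
  rewrite -uE -tyE uE (pbBl pbP) (pbMl pbP) (pbxx pbP) pzx mE mb.
  by rewrite (pb_anti pbP exchange_rest x); ring.
have {tx} tE' : t = - (b%:MP * x).
  by apply: (mulIf (mpolyX_neq0 K k)); rewrite tx; ring.
have : (c%:MP + lam%:MP * exchange_rest) * x + delta' k1 exchange_rest = 0 * x + 0.
  move: tu; rewrite tE' pxu mpolyCD => h.
  transitivity (- (b%:MP * x) * exchange_rest + (c%:MP * x +
     ((b%:MP + lam%:MP) * exchange_rest * x + delta' k1 exchange_rest))); first by ring.
  rewrite h; ring.
move/(congr1 (mderiv k)); rewrite !mderiv_lin ?rpred0 ?rpredD ?rpredM ?indepC // => h.
exists (- (lam^-1 * c)); apply: (mulfI (x := lam%:MP)); first by rewrite mpolyC_eq0.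
rewrite mpolyCN mpolyCM mulrN mulrA -mpolyCM mulfV // mpolyC1 mul1r.
by apply: (addrI c%:MP); rewrite h subrr.
Qed.

End Exchange.

Theorem theorem7p3 (K : fieldType) (charK0 : [pchar K] =i pred0) (N r : nat)
  (pb : {mpoly K[N]} -> {mpoly K[N]} -> {mpoly K[N]})
  (act : {ffun 'I_r -> K} -> {mpoly K[N]} -> {mpoly K[N]})
  (sigma delta : 'I_N -> {mpoly K[N]} -> {mpoly K[N]})
  (cgl : poisson_CGL pb act 1%g sigma delta)
  (k k1 : 'I_N) (k1E : k1 = k.+1 :> nat)
  (delta_const : exists c : K, delta k1 'X_k = c%:MP)
  (eta : 'I_N -> int) (y : 'I_N -> {mpoly K[N]})
  (yP : homogeneous_primes pb act 1%g eta y)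
  (eta_k : eta k = eta k1)
  (sigma' delta' : 'I_N -> {mpoly K[N]} -> {mpoly K[N]})
  (sd'E : forall j : 'I_N, j != k -> j != k1 ->
     {in stage 1%g j, sigma' j =1 sigma j} /\
     {in stage 1%g j, delta' j =1 delta j})
  (cgl' : poisson_CGL pb act (tperm k k1) sigma' delta')
  (eta' : 'I_N -> int) (y' : 'I_N -> {mpoly K[N]})
  (y'P : homogeneous_primes pb act (tperm k k1) eta' y') :
  exists (kappa : K) (m : 'I_N -> nat),
  [/\ kappa != 0,
      tofrac (y' k) = (tofrac (y k))^-1 *
        tofrac ((if eta_pred eta k is Some j then y j else 1) * y k1 +
                kappa *: \prod_(i in last_levels eta k | Some i != eta_pred eta k)
                            y i ^+ m i)
    & eta_pred eta k = None -> {in last_levels eta k, forall i, m i = 0%N}].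
Proof.
pose u := exchange_rest k k1 eta y y'.
have u0 : u != 0 := exchange_rest_neq0 k1E cgl cgl' yP y'P eta_k.
suff [kappa [m [kap0 uE m0]]] : exists (kappa : K) (m : 'I_N -> nat),
  [/\ kappa != 0,
     u = kappa *: \prod_(i in last_levels eta k | Some i != eta_pred eta k) y i ^+ m i
   & eta_pred eta k = None -> {in last_levels eta k, forall i, m i = 0%N}].
  exists kappa, m; split=> //; rewrite -uE.
  have -> : lead eta y k * y k1 + u = y k * y' k by rewrite /u /exchange_rest addrC subrK.
  by rewrite rmorphM mulKf // tofrac_eq0 (y_neq0 yP).
case E : (eta_pred eta k) => [j|]; last first.
  have [c cE] := delta_const.
  have [kappa uE] := exchange_rest_const k1E cgl cgl' yP y'P eta_k cE E.
  exists kappa, (fun=> 0%N); split=> //; last first.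
    by rewrite big1 ?alg_mpolyC // => i _; rewrite expr0.
  by apply: contraNneq u0 => kap0; rewrite /u uE kap0 mpolyC0.
have [kappa [m [kap0 uE]]] := normal_factor cgl yP charK0 (ltnW (ltn_ord k))
  (exchange_rest_stage k1E cgl cgl' yP y'P eta_k) u0
  (exchange_rest_homogeneous k1E cgl cgl' yP y'P eta_k)
  (exchange_rest_normal k1E cgl cgl' yP y'P eta_k).
exists kappa, m; split=> //; rewrite /u uE -mul_mpolyC; congr (_ * _).
have [[|f] fE] := prod_levels_lead eta y k m; rewrite fE E; first by rewrite mul1r.
set rest := \prod_(i in _ | _) _ in fE.
case: (lead_not_dvd_exchange_rest k1E cgl cgl' yP y'P eta_k
         (d := kappa%:MP * (lead eta y k ^+ f * rest))).
  by rewrite E.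
by rewrite uE fE exprS; ring.
Qed.
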